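(* Let $\mathcal{A}$ be a unital $C^*$-algebra and let $\{x_n\}_{n\in\mathbb{N}}\subseteq H_{\mathcal{A}}$ be a Bessel sequence. Then $\{x_n\}_{n\in\mathbb{N}}$ is a pseudo-Riesz sequence if and only if the associated synthesis operator $\Theta^*$ is upper semi-$\mathcal{A}$-Fredholm.
   Context: $\mathcal{A}$ is a unital $C^*$-algebra and $H_{\mathcal{A}}$ is the standard Hilbert $\mathcal{A}$-module: sequences $(a_i)_{i\ge 1}$ in $\mathcal{A}$ with $\sum_i a_ia_i^*$ norm-convergent, left $\mathcal{A}$-action, inner product $\langle a,b\rangle=\sum_i a_ib_i^*$, and standard orthonormal basis $\{e_i\}_{i\in\mathbb{N}}$, where $\mathbb{N}=\{1,2,\dots\}$. $B^a(H_{\mathcal{A}})$ is the algebra of bounded adjointable $\mathcal{A}$-linear operators on $H_{\mathcal{A}}$. $M=M_1\tilde\oplus M_2$ means that $M_1,M_2$ are closed submodules of $M$ with $M_1\cap M_2=\{0\}$ and $M_1+M_2=M$ (not necessarily orthogonal). An isomorphism of Hilbert modules is a bounded $\mathcal{A}$-linear bijection with bounded inverse. Finitely generated means algebraically finitely generated over $\mathcal{A}$. Bessel sequence: a sequence $\{f_n\}$ in a Hilbert $\mathcal{A}$-module $\mathcal X$ such that for some constant $M>0$, $\sum_n\langle x,f_n\rangle\langle f_n,x\rangle\le M\langle x,x\rangle$ for all $x\in\mathcal X$, the sum converging in norm. Its synthesis operator is $\Theta^*:H_{\mathcal{A}}\to\mathcal X$, $\Theta^*(c)=\sum_n c_nf_n$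 for $c=(c_n)\in H_{\mathcal{A}}$ (so $\Theta^*(e_n)=f_n$); it is the adjoint of the analysis operator $\Theta(x)=\sum_n\langle x,f_n\rangle e_n$. Modular Riesz basis: a sequence $\{y_i\}_{i\ge1}$ in a countably generated Hilbert $\mathcal{A}$-module $\mathcal X$ is a modular Riesz basis for $\mathcal X$ if the $\mathcal{A}$-linear operator from $H_{\mathcal{A}}$ onto $\mathcal X$ mapping $e_i$ to $y_i$ for every $i$ is invertible and adjointable. A tail $\{f_n\}_{n=m+1}^\infty$ is regarded as the sequence $y_i=f_{m+i}$. Pseudo-Riesz sequence: a Bessel sequence $\{f_n\}_{n\in\mathbb{N}}\subseteq H_{\mathcal{A}}$ for which there is $m\in\mathbb{N}$ such that $\{f_n\}_{n=m+1}^\infty$ is a modular Riesz basis for $\overline{\operatorname{Span}_{\mathcal{A}}\{f_n\mid n\ge m+1\}}$. Upper semi-$\mathcal{A}$-Fredholm: $F\in B^a(H_{\mathcal{A}})$ for which there are decompositions $H_{\mathcal{A}}=M_1\tilde\oplus N_1$ and $H_{\mathcal{A}}=M_2\tilde\oplus N_2$ into closed submodules with $F(M_1)\subseteq M_2$, $F(N_1)\subseteq N_2$, $F|_{M_1}:M_1\to M_2$ an isomorphism, and $N_1$ finitely generated. *)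

(* Defs.v *)
From HB Require Import structures.
From mathcomp Require Import all_boot all_order all_algebra.
From mathcomp Require Import all_classical all_reals all_analysis.
From mathcomp.real_closed Require Import complex.

Set Implicit Arguments.
Unset Strict Implicit.
Unset Printing Implicit Defensive.

Import Order.TTheory GRing.Theory Num.Theory.
Import numFieldNormedType.Exports.

Local Open Scope classical_set_scope.
Local Open Scope ring_scope.
Local Open Scope complex_scope.

(* Unital complex C*-algebras (possibly zero).  The product and the unit are
   fields of the mixin because the hierarchy has no common instance of its
   rings and its normed modules below the number domains. *)
HB.mixin Record isCStarAlgebra (R : realType) A
    & CompleteNormedModule R[i] A := {
  cmul : A -> A -> A;
  cone : A;
  star : A -> A;
  cmulA : associative cmul;
  cmul1l : left_id cone cmul;
  cmul1r : right_id cone cmul;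
  cmulDl : left_distributive cmul +%R;
  cmulDr : right_distributive cmul +%R;
  cscaleAl : forall (k : R[i]) (a b : A), k *: cmul a b = cmul (k *: a) b;
  cscaleAr : forall (k : R[i]) (a b : A), k *: cmul a b = cmul a (k *: b);
  cnormM_le : forall a b : A, `|cmul a b| <= `|a| * `|b|;
  starK : involutive star;
  starD : forall a b : A, star (a + b) = star a + star b;
  starZ : forall (k : R[i]) (a : A), star (k *: a) = Num.conj k *: star a;
  starM : forall a b : A, star (cmul a b) = cmul (star b) (star a);
  cnorm_star_mul : forall a : A, `|cmul (star a) a| = `|a| ^+ 2
}.

#[short(type="cstarAlgType")]
HB.structure Definition CStarAlgebra (R : realType) :=
  {A of CompleteNormedModule R[i] A & isCStarAlgebra R A}.

Notation "a ** b" := (cmul a b) (at level 40, left associativity) : ring_scope.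

Section Defs.
Context {R : realType} {A : cstarAlgType R}.
Implicit Types (a b : A) (x y : nat -> A) (M N X Y : set (nat -> A)).

Definition cstar_le a b : Prop := exists c : A, b - a = star c ** c.

(* H_A is the set [HA] of square-summable sequences inside [nat -> A], with
   the pointwise addition; the index i >= 1 of the coordinates is shifted to
   i >= 0.  All notions below only look at elements of [HA]. *)

Definition HA : set (nat -> A) :=
  [set x | cvgn (series (fun i => x i ** star (x i)))].

Definition hact a x : nat -> A := fun i => a ** x i.

Definition hip x y : A := limn (series (fun i => x i ** star (y i))).

(* The norm of [A] takes its (nonnegative real) values in R[i]. *)
Definition hnorm x : R := Num.sqrt (complex.Re `|hip x x|).

Definition hbasis (n : nat) : nat -> A := fun i => if i == n then cone else 0.

Definition hcvg (u : nat -> nat -> A) x : Prop :=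
  (fun n => hnorm (u n - x)) @ \oo --> (0 : R).

Definition hclosure X : set (nat -> A) :=
  [set x | HA x /\
    forall e : R, 0 < e -> exists y, X y /\ hnorm (x - y) < e].

Definition hspan (f : nat -> nat -> A) : set (nat -> A) :=
  [set x | exists (k : nat) (c : nat -> A), x = \sum_(i < k) hact (c i) (f i)].

Definition closed_submodule M : Prop :=
  [/\ M `<=` HA, M 0,
      forall x y, M x -> M y -> M (x + y),
      forall a x, M x -> M (hact a x)
    & hclosure M `<=` M].

Definition countably_generated X : Prop :=
  exists g : nat -> nat -> A, (forall n, X (g n)) /\ X = hclosure (hspan g).

Definition finitely_generated X : Prop :=
  exists (k : nat) (g : 'I_k -> nat -> A),
    X = [set x | exists c : 'I_k -> A, x = \sum_(i < k) hact (c i) (g i)].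

Definition direct_sum M N : Prop :=
  [/\ closed_submodule M, closed_submodule N, M `&` N = [set 0]
    & [set x + y | x in M & y in N] = HA].

Definition bounded_operator X Y (F : (nat -> A) -> (nat -> A)) : Prop :=
  [/\ forall x, X x -> Y (F x),
      forall x y, X x -> X y -> F (x + y) = F x + F y,
      forall a x, X x -> F (hact a x) = hact a (F x)
    & exists C : R, forall x, X x -> hnorm (F x) <= C * hnorm x].

Definition hilbert_iso X Y (F : (nat -> A) -> (nat -> A)) : Prop :=
  bounded_operator X Y F /\
  exists G : (nat -> A) -> (nat -> A),
    [/\ bounded_operator Y X G, forall x, X x -> G (F x) = x
      & forall y, Y y -> F (G y) = y].

Definition adjointable X Y (F : (nat -> A) -> (nat -> A)) : Prop :=
  exists G : (nat -> A) -> (nat -> A),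
    (forall y, Y y -> X (G y)) /\
    forall x y, X x -> Y y -> hip (F x) y = hip x (G y).

Definition bessel (f : nat -> nat -> A) : Prop :=
  (forall n, HA (f n)) /\
  exists M : R, 0 < M /\
    forall x, HA x ->
      let u := series (fun n => hip x (f n) ** hip (f n) x) in
      cvgn u /\ cstar_le (limn u) (M%:C *: hip x x).

(* The sum of the series of the c_n f_n for the norm of H_A (for Bessel [f]
   and [c] in [HA] this limit exists and is unique; 0 is a junk value). *)
Definition synthesis (f : nat -> nat -> A) (c : nat -> A) : nat -> A :=
  xget 0 [set x | HA x /\ hcvg (fun k => \sum_(n < k) hact (c n) (f n)) x].

Definition modular_riesz_basis X (f : nat -> nat -> A) : Prop :=
  [/\ closed_submodule X, countably_generated X
    & exists U : (nat -> A) -> (nat -> A),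
        [/\ hilbert_iso HA X U, adjointable HA X U
          & forall n, U (hbasis n) = f n]].

(* With the indices shifted by one, the tail f_(m+1), f_(m+2), ... of the
   sequence starts at position m. *)
Definition pseudo_riesz (f : nat -> nat -> A) : Prop :=
  bessel f /\
  exists m : nat, (0 < m)%N /\
    let tail := fun i => f (m + i)%N in
    modular_riesz_basis (hclosure (hspan tail)) tail.

Definition upper_semi_fredholm (F : (nat -> A) -> (nat -> A)) : Prop :=
  [/\ bounded_operator HA HA F, adjointable HA HA F
    & exists M1 N1 M2 N2 : set (nat -> A),
        [/\ direct_sum M1 N1 /\ direct_sum M2 N2,
            (forall x, M1 x -> M2 (F x)) /\ (forall x, N1 x -> N2 (F x)),
            hilbert_iso M1 M2 F
          & finitely_generated N1]].

End Defs.

(* Main.v *)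
Require Import Defs.
From mathcomp Require Import all_boot all_order all_algebra.
From mathcomp Require Import all_classical all_reals all_analysis.
From mathcomp.real_closed Require Import complex.
From mathcomp Require Import ring lra.

(** Write F for the synthesis operator of the Bessel sequence f, and T for its
    restriction to the sequences vanishing before position m, reindexed so as
    to start at 0; thus T maps the i-th basis vector to f (m + i).  Both sides
    of the equivalence amount to [tail_bounded_below f m] for some m: an
    inequality |c| <= C |T c|.

    For the Riesz property this is elementary.  If the tail is a Riesz basis,
    T is the given invertible operator, since both agree on the basis vectors.
    If T is bounded below, its range is closed, hence it is the closure of the
    span of the tail, and T is invertible onto it
    ([riesz_tail_bounded_below], [bounded_below_riesz_tail]).

    A lower bound gives a Fredholm decomposition
    ([bounded_below_fredholm]).  T is adjointable and bounded below, so
    T^* T is onto ([positive_surjective]) and H_A is the direct sum of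
    M2 = range T and N2 = ker T^*.  Let M1 be the space of sequences vanishing
    before m and N1 = F^-1(N2).  Then F is an isomorphism of M1 onto M2, and
    N1 is a complement of M1 generated by the basis vectors e_i, i < m, each
    corrected by an element of M1.

    Conversely, let F be upper semi-Fredholm ([fredholm_bounded_below]).  As
    N1 is generated by finitely many g_i, it is the range of the operator
    S : c |-> sum_i c_i g_i, whose adjoint collects the products <y, g_i>.  By
    the open mapping theorem S^* is bounded below on N1, so S S^* is onto N1
    and N1 has an orthogonal projection P with |P h| <= L |S^* h|.  If h
    vanishes before m, then S^* h only involves the tails of the g_i, so that
    |P h| <= eps |h| once m is large.  Now h - P h is orthogonal to N1; hence
    it is no longer than its component c1 in M1.  Finally F is bounded below
    on M1, and F c1 is bounded by F (h - P h) because the projections of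
    H_A = M2 + N2 are bounded, again by the open mapping theorem.

    All of this rests on the Cauchy-Schwarz inequality in H_A, thus on the
    order of a C*-algebra.  Positivity is characterized by the norm, so that
    positive elements form a cone; the theorem that c^* c is positive
    ([pos_star_mul]) is obtained from square roots, without spectra. *)

Set Implicit Arguments.
Unset Strict Implicit.
Unset Printing Implicit Defensive.

Import Order.TTheory GRing.Theory Num.Theory.
Import numFieldNormedType.Exports.

Local Open Scope classical_set_scope.
Local Open Scope ring_scope.
Local Open Scope complex_scope.

(** * Identities in abelian groups *)

(** Formal expressions over the operations of an abelian group.  The tactic
    [abelian] proves an equation by comparing, for each atom, its
    multiplicities on both sides. *)
Inductive zexp := ZAtom of nat | ZZero | ZAdd of zexp & zexp | ZOpp of zexp.

Fixpoint zeval (V : zmodType) (s : seq V) (e : zexp) : V :=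
  match e with
  | ZAtom n => nth 0 s n
  | ZZero => 0
  | ZAdd e f => zeval s e + zeval s f
  | ZOpp e => - zeval s e
  end.

Fixpoint zcoef (e : zexp) (n : nat) : int :=
  match e with
  | ZAtom m => (m == n)%:R
  | ZZero => 0
  | ZAdd e f => zcoef e n + zcoef f n
  | ZOpp e => - zcoef e n
  end.

Lemma zevalE (V : zmodType) (s : seq V) e :
  zeval s e = \sum_(n < size s) s`_n *~ zcoef e n.
Proof.
elim: e => [m||e IHe f IHf|e IHe] /=.
- have [ms|ms] := ltnP m (size s); last first.
    rewrite nth_default// big1// => i _.
    by rewrite gtn_eqF ?mulr0z//; exact: leq_trans ms.
  rewrite (bigD1 (Ordinal ms))//= eqxx mulr1z big1 ?addr0// => i /eqP im.
  by case: eqP => [mi|_]; rewrite ?mulr0z//; case: im; exact: val_inj.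
- by rewrite big1.
- by rewrite IHe IHf -big_split /=; apply: eq_bigr => i _; rewrite mulrzDr.
- by rewrite IHe -sumrN; apply: eq_bigr => i _; rewrite mulrNz.
Qed.

Lemma zexp_eq (V : zmodType) (s : seq V) e f :
  all (fun n => zcoef e n == zcoef f n) (iota 0 (size s)) ->
  zeval s e = zeval s f.
Proof.
move=> /allP ef; rewrite !zevalE; apply: eq_bigr => i _.
by rewrite (eqP (ef i _)) // mem_iota /=.
Qed.

Ltac zindex x s :=
  match s with
  | ?y :: _ => let _ := match goal with _ => unify x y end in constr:(0%N)
  | _ :: ?s' => let n := zindex x s' in constr:(n.+1)
  end.
Ltac zatoms s t :=
  match t with
  | (?a + ?b)%R => let s1 := zatoms s a in zatoms s1 b
  | (- ?a)%R => zatoms s a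
  | 0%R => s
  | _ => match s with
         | _ => let n := zindex t s in s
         | _ => constr:(t :: s)
         end
  end.
Ltac zreify s t :=
  match t with
  | (?a + ?b)%R => let e := zreify s a in let f := zreify s b in
                   constr:(ZAdd e f)
  | (- ?a)%R => let e := zreify s a in constr:(ZOpp e)
  | 0%R => constr:(ZZero)
  | _ => let n := zindex t s in constr:(ZAtom n)
  end.
Ltac abelian :=
  match goal with |- @eq ?T ?x ?y =>
    let s0 := zatoms (@nil T) x in let s := zatoms s0 y in
    let e := zreify s x in let f := zreify s y in
    exact: (@zexp_eq _ s e f isT)
  end.

(** * The norm and the involution of a C*-algebra *)

Section CStar.
Context {R : realType} {A : cstarAlgType R}.
Implicit Types (a b c h k : A) (s t : R).

(** The norm of [A] has its values in [R[i]]; this is the same number in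
    [R], where order and square roots are at hand. *)
Definition nrm a : R := complex.Re `|a|.

Lemma nrmE a : `|a| = (nrm a)%:C.
Proof. by rewrite /nrm RRe_real// ger0_real. Qed.

Lemma nrm_ge0 a : 0 <= nrm a.
Proof. by rewrite -ler0c -nrmE. Qed.

Lemma nrm0 : nrm (0 : A) = 0.
Proof. by rewrite /nrm normr0. Qed.

Lemma nrm0_eq0 a : nrm a <= 0 -> a = 0.
Proof.
move=> a0; have {a0} a0 : nrm a = 0 by apply/le_anti; rewrite a0 nrm_ge0.
by apply/eqP; rewrite -normr_eq0 nrmE a0.
Qed.

Lemma nrmD a b : nrm (a + b) <= nrm a + nrm b.
Proof. by rewrite -lecR rmorphD/= -!nrmE ler_normD. Qed.

Lemma nrmN a : nrm (- a) = nrm a.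
Proof. by rewrite /nrm normrN. Qed.

Lemma nrmB a b : nrm (a - b) <= nrm a + nrm b.
Proof. by rewrite (le_trans (nrmD _ _))// nrmN. Qed.

Lemma nrm_distC a b : nrm (a - b) = nrm (b - a).
Proof. by rewrite -nrmN opprB. Qed.

Lemma nrmM a b : nrm (a ** b) <= nrm a * nrm b.
Proof. by rewrite -lecR rmorphM/= -!nrmE cnormM_le. Qed.

Lemma nrmZ t a : nrm (t%:C *: a) = `|t| * nrm a.
Proof.
rewrite /nrm normrZ nrmE normc_def /= expr0n addr0 sqrtr_sqr.
by rewrite mul0r subr0.
Qed.

Lemma nrmZ_ge0 t a : 0 <= t -> nrm (t%:C *: a) = t * nrm a.
Proof. by move=> t0; rewrite nrmZ ger0_norm. Qed.

Lemma nrm_star_mul a : nrm (star a ** a) = nrm a ^+ 2.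
Proof.
have := cnorm_star_mul a; rewrite !nrmE => /eqP.
by rewrite -rmorphXn /= eq_complex /= eqxx andbT => /eqP.
Qed.

(** The C*-identity gives |a|^2 <= |a^*| |a|, and symmetrically. *)
Lemma nrm_star a : nrm (star a) = nrm a.
Proof.
have H b : nrm b <= nrm (star b).
  have [b0|b0] := eqVneq (nrm b) 0; first by rewrite b0 nrm_ge0.
  have bp : 0 < nrm b by rewrite lt_def b0 nrm_ge0.
  by rewrite -(ler_pM2r bp) -expr2 -nrm_star_mul nrmM.
by apply/le_anti; rewrite H andbT -{2}(starK a) H.
Qed.

Lemma nrm_mul_star a : nrm (a ** star a) = nrm a ^+ 2.
Proof. by rewrite -{1}(starK a) nrm_star_mul nrm_star. Qed.

Lemma cmul0l a : 0 ** a = 0.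
Proof. by apply: (addrI (0 ** a)); rewrite -cmulDl !addr0. Qed.

Lemma cmul0r a : a ** 0 = 0.
Proof. by apply: (addrI (a ** 0)); rewrite -cmulDr !addr0. Qed.

Lemma cmulNl a b : (- a) ** b = - (a ** b).
Proof. by apply/eqP; rewrite -addr_eq0 -cmulDl addNr cmul0l. Qed.

Lemma cmulNr a b : a ** (- b) = - (a ** b).
Proof. by apply/eqP; rewrite -addr_eq0 -cmulDr addNr cmul0r. Qed.

Lemma cmulBl a b c : (a - b) ** c = a ** c - b ** c.
Proof. by rewrite cmulDl cmulNl. Qed.

Lemma cmulBr a b c : c ** (a - b) = c ** a - c ** b.
Proof. by rewrite cmulDr cmulNr. Qed.

Lemma cmul_sumr (I : Type) (r : seq I) (F : I -> A) a :
  a ** (\sum_(i <- r) F i) = \sum_(i <- r) a ** F i.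
Proof.
elim: r => [|i r IH]; rewrite ?big_nil ?cmul0r// !big_cons.
by rewrite cmulDr IH.
Qed.

Lemma star0 : star (0 : A) = 0.
Proof. by apply: (addrI (star (0 : A))); rewrite -starD !addr0. Qed.

Lemma starN a : star (- a) = - star a.
Proof. by apply/eqP; rewrite -addr_eq0 -starD addNr star0. Qed.

Lemma starB a b : star (a - b) = star a - star b.
Proof. by rewrite starD starN. Qed.

Lemma star1 : star (cone : A) = cone.
Proof. by rewrite -[LHS]cmul1r -[X in _ ** X = _]starK -starM cmul1r starK. Qed.

Lemma starZr t a : star (t%:C *: a) = t%:C *: star a.
Proof. by rewrite starZ; congr (_ *: _); rewrite -[RHS]conjc_real. Qed.

Lemma star_sum (I : Type) (r : seq I) (F : I -> A) :
  star (\sum_(i <- r) F i) = \sum_(i <- r) star (F i).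
Proof.
elim: r => [|i r IH]; rewrite ?big_nil ?star0// !big_cons.
by rewrite starD IH.
Qed.

Lemma scaleC_half a : (2^-1 : R)%:C *: (a + a) = a.
Proof.
rewrite scalerDr -scalerDl -rmorphD/= (_ : _ + _ = 1); first by rewrite scale1r.
by field.
Qed.

Lemma cvgA (u : nat -> A) (l : A) :
  u @ \oo --> l <->
  (forall e : R, 0 < e -> \forall n \near \oo, nrm (u n - l) < e).
Proof.
split=> [/cvgrPdist_lt ul e e0|ul].
  have /ul : 0 < e%:C by rewrite ltcR.
  apply: filterS => n; rewrite nrmE ltcR.
  by rewrite nrm_distC.
apply/cvgrPdist_lt => e e0.
have eE : e = (complex.Re e)%:C by rewrite RRe_real// gtr0_real.
have e'0 : 0 < complex.Re e by rewrite -ltcR -eE.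
apply: filterS (ul _ e'0) => n; rewrite nrm_distC => h.
by rewrite nrmE eE ltcR.
Qed.

Lemma cauchyA (u : nat -> A) :
  (forall e : R, 0 < e ->
     exists N, forall m n, (N <= m <= n)%N -> nrm (u n - u m) < e) ->
  exists l : A, u @ \oo --> l.
Proof.
move=> uC; suff uc : cvgn u by exists (limn u).
apply/cauchy_cvgP; apply/cauchy_exP => e e0.
have eE : e = (complex.Re e)%:C by rewrite RRe_real// gtr0_real.
have e'0 : 0 < complex.Re e by rewrite -ltcR -eE.
have [N HN] := uC _ e'0.
exists (u N); exists N => //= n Nn; rewrite -ball_normE /ball_ /=.
by rewrite nrmE eE ltcR nrm_distC HN// leqnn.
Qed.

End CStar.

(** * Positive elements *)

Section Positivity.
Context {R : realType} {A : cstarAlgType R}.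
Implicit Types (a b c h k : A) (s t : R).

Lemma cvgA_star (u : nat -> A) (l : A) :
  u @ \oo --> l -> (fun n => star (u n)) @ \oo --> star l.
Proof.
move=> /cvgA ul; apply/cvgA => e e0; apply: filterS (ul e e0) => n.
by rewrite -starB nrm_star.
Qed.

Lemma cvgA_mul (u v : nat -> A) (l m : A) :
  u @ \oo --> l -> v @ \oo --> m -> (fun n => u n ** v n) @ \oo --> l ** m.
Proof.
move=> /cvgA ul /cvgA vm; apply/cvgA => e e0.
pose K := 1 + nrm m + nrm l; have K0 : 0 < K.
  by rewrite /K; have := nrm_ge0 m; have := nrm_ge0 l; lra.
pose d := Num.min 1 (e / K).
have d0 : 0 < d by rewrite lt_min ltr01 divr_gt0.
apply: filterS2 (ul d d0) (vm d d0) => n /=.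
set x := u n - l; set y := v n - m; move=> xd yd.
have -> : u n ** v n - l ** m = x ** y + x ** m + l ** y.
  rewrite /x /y !(cmulBl, cmulBr); abelian.
apply: (le_lt_trans (nrmD _ _)).
have H1 := nrmD (x ** y) (x ** m).
have H2 := nrmM x y; have H3 := nrmM x m; have H4 := nrmM l y.
have d1 : d <= 1 by rewrite ge_min lexx.
have dK : d * K <= e by rewrite -ler_pdivlMr// ge_min lexx orbT.
have x0 := nrm_ge0 x; have y0 := nrm_ge0 y.
have m0 := nrm_ge0 m; have l0 := nrm_ge0 l.
have : nrm x * nrm y <= nrm x * 1 by rewrite ler_wpM2l//; lra.
have : nrm x * nrm m <= d * nrm m by rewrite ler_wpM2r//; lra.
have : nrm l * nrm y <= nrm l * d by rewrite ler_wpM2l//; lra.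
by rewrite /K in dK; lra.
Qed.

Lemma nrm_le_lim (u : nat -> A) (l : A) t :
  u @ \oo --> l -> (\forall n \near \oo, nrm (u n) <= t) -> nrm l <= t.
Proof.
move=> /cvgA ul ut; apply/ler_addgt0Pr => e e0.
near \oo => n.
have h1 : nrm (u n) <= t by near: n.
have h2 : nrm (u n - l) < e by near: n; exact: ul.
have -> : l = u n - (u n - l) by abelian.
by rewrite (le_trans (nrmB _ _))// lerD// ltW.
Unshelve. all: by end_near. Qed.

Lemma cvgA_unique (u : nat -> A) (l m : A) :
  u @ \oo --> l -> u @ \oo --> m -> l = m.
Proof.
move=> ul um; apply/eqP; rewrite -subr_eq0; apply/eqP/nrm0_eq0.
apply: (nrm_le_lim (cvgB ul um)); apply: nearW => n.
by rewrite /= subrr nrm0.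
Qed.

(** The real scalars, as central elements of the algebra. *)
Definition emb t : A := t%:C *: cone.

Lemma cmulZl t a b : (t%:C *: a) ** b = t%:C *: (a ** b).
Proof. by rewrite cscaleAl. Qed.

Lemma cmulZr t a b : a ** (t%:C *: b) = t%:C *: (a ** b).
Proof. by rewrite cscaleAr. Qed.

Lemma emb_mul t a : emb t ** a = t%:C *: a.
Proof. by rewrite cmulZl cmul1l. Qed.

Lemma mul_emb t a : a ** emb t = t%:C *: a.
Proof. by rewrite cmulZr cmul1r. Qed.

Lemma embD s t : emb (s + t) = emb s + emb t.
Proof. by rewrite /emb rmorphD scalerDl. Qed.

Lemma star_emb t : star (emb t) = emb t.
Proof. by rewrite /emb starZr star1. Qed.

Lemma nrm1 : nrm (cone : A) <= 1.
Proof.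
have := nrm_star_mul (cone : A); rewrite star1 cmul1l => h.
have [->//|n0] := eqVneq (nrm (cone : A)) 0.
by rewrite -(mulfI n0 (etrans (mulr1 _) h)).
Qed.

Lemma nrm_emb t : nrm (emb t) <= `|t|.
Proof. by rewrite nrmZ -{2}[`|t|]mulr1 ler_wpM2l// nrm1. Qed.

(** For |a| <= 1 these iterates converge to y = (a + y^2) / 2, so that 1 - y is
    a square root of 1 - a. *)
Fixpoint sqrt_iter a n : A :=
  if n is n'.+1 then
    (2^-1 : R)%:C *: (a + sqrt_iter a n' ** sqrt_iter a n')
  else 0.

(** The iteration for the scalar 1: its increments dominate those of
    [sqrt_iter a] when |a| <= 1. *)
Fixpoint sqrt_major n : R :=
  if n is n'.+1 then (1 + sqrt_major n' ^+ 2) / 2 else 0.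

Lemma sqrt_major_le n : 0 <= sqrt_major n <= 1.
Proof. elim: n => [|n /andP[h1 h2]] /=; first by lra. by apply/andP; nra. Qed.

Lemma sqrt_major_homo n : sqrt_major n <= sqrt_major n.+1.
Proof. have := sqr_ge0 (1 - sqrt_major n); rewrite /=; nra. Qed.

Lemma sqrt_iter_comm a c n :
  c ** a = a ** c -> c ** sqrt_iter a n = sqrt_iter a n ** c.
Proof.
move=> ca; elim: n => [|n IH] /=; first by rewrite cmul0l cmul0r.
by rewrite cmulZr cmulZl cmulDr cmulDl ca cmulA IH -!cmulA IH.
Qed.

Lemma sqrt_iter_star a n : star a = a -> star (sqrt_iter a n) = sqrt_iter a n.
Proof.
by move=> sa; elim: n => [|n IH] /=; rewrite ?star0// starZr starD starM IH sa.
Qed.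

Lemma sqrt_iter_nrm a n : nrm a <= 1 -> nrm (sqrt_iter a n) <= sqrt_major n.
Proof.
move=> a1; elim: n => [|n IH] /=; first by rewrite nrm0.
rewrite nrmZ_ge0 ?invr_ge0// mulrC ler_pM2r ?invr_gt0//.
rewrite (le_trans (nrmD _ _))// lerD// (le_trans (nrmM _ _))// expr2.
by rewrite ler_pM// nrm_ge0.
Qed.

(** With y' and y two consecutive iterates, the next increment is
    (y' - y) (y' + y) / 2, and the same formula holds for the majorant. *)
Lemma sqrt_iter_incr a n : nrm a <= 1 ->
  nrm (sqrt_iter a n.+1 - sqrt_iter a n) <= sqrt_major n.+1 - sqrt_major n.
Proof.
move=> a1; elim: n => [|n IH].
  rewrite /= subr0 cmul0l addr0 nrmZ_ge0 ?invr_ge0// expr0n /=; lra.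
set y' := sqrt_iter a n.+1 in IH *; set y := sqrt_iter a n in IH *.
have yy' : y ** y' = y' ** y.
  by apply: sqrt_iter_comm; rewrite sqrt_iter_comm.
have -> : sqrt_iter a n.+2 - y' = (2^-1 : R)%:C *: ((y' - y) ** (y' + y)).
  have -> : sqrt_iter a n.+2 - y' =
      (2^-1 : R)%:C *: (a + y' ** y') - (2^-1 : R)%:C *: (a + y ** y) by [].
  rewrite cmulDr !cmulBl yy' -scalerBr; congr (_ *: _); abelian.
rewrite nrmZ_ge0 ?invr_ge0//.
have := nrmM (y' - y) (y' + y); have := nrmD y' y.
have := sqrt_iter_nrm n a1; have := sqrt_iter_nrm n.+1 a1.
rewrite -/y -/y' => h1 h2 h3 h4.
have : nrm (y' - y) * nrm (y' + y) <=
    (sqrt_major n.+1 - sqrt_major n) * (sqrt_major n.+1 + sqrt_major n).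
  by apply: ler_pM => //; rewrite ?nrm_ge0//; lra.
have q2 m : sqrt_major m.+1 = (1 + sqrt_major m ^+ 2) / 2 by [].
rewrite (q2 n.+1); have := q2 n; set q' := sqrt_major n.+1.
move=> q'E /(le_trans h4); rewrite -(@ler_pM2l _ 2^-1) ?invr_gt0// => h5.
by apply: (le_trans h5); lra.
Qed.

Lemma sqrt_iter_dist a n m : nrm a <= 1 -> (n <= m)%N ->
  nrm (sqrt_iter a m - sqrt_iter a n) <= sqrt_major m - sqrt_major n.
Proof.
move=> a1 /subnK <-; elim: (m - n)%N => [|k IH].
  by rewrite add0n !subrr nrm0.
rewrite addSn.
have -> : sqrt_iter a (k + n).+1 - sqrt_iter a n =
  (sqrt_iter a (k + n).+1 - sqrt_iter a (k + n)) +
  (sqrt_iter a (k + n) - sqrt_iter a n) by abelian.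
rewrite (le_trans (nrmD _ _))//.
have := sqrt_iter_incr (k + n) a1; move: IH; lra.
Qed.

Lemma sqrt_iter_cvg a : nrm a <= 1 ->
  exists y : A, sqrt_iter a @ \oo --> y.
Proof.
move=> a1; apply: cauchyA => e e0.
have qc : cvgn sqrt_major.
  apply: nondecreasing_is_cvgn.
    by apply/nondecreasing_seqP => n; exact: sqrt_major_homo.
  by exists 1 => _ [n _ <-]; have /andP[] := sqrt_major_le n.
have e20 : 0 < e / 2 by lra.
have /cvgrPdist_lt/(_ _ e20)[N _ HN] := qc.
exists N => m n /andP[Nm mn].
apply: (le_lt_trans (sqrt_iter_dist a1 mn)).
have := HN _ Nm; have := HN _ (leq_trans Nm mn).
by rewrite /= !ltr_norml; lra.
Qed.

(** The square root is a limit of polynomials in [a], hence commutes with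
    whatever commutes with [a]. *)
Lemma unit_sqrt a : star a = a -> nrm (cone - a) <= 1 ->
  exists h, [/\ star h = h, h ** h = a, nrm (cone - h) <= 1
    & forall c, c ** a = a ** c -> c ** h = h ** c].
Proof.
move=> sa a1; set x := cone - a in a1.
have sx : star x = x by rewrite /x starB star1 sa.
have [y xy] := sqrt_iter_cvg a1.
have yE : y + y = x + y ** y.
  have yE : y = (2^-1 : R)%:C *: (x + y ** y).
    apply: (@cvgA_unique (fun n => sqrt_iter x n.+1)) => //.
      by rewrite (cvg_shiftS (sqrt_iter x)).
    by apply: cvgZr; apply: cvgD; [exact: cvg_cst|exact: cvgA_mul].
  by rewrite {1 2}yE -scalerDr scaleC_half.
exists (cone - y); split.
- rewrite starB star1; congr (_ - _).
  apply: (@cvgA_unique (sqrt_iter x)) => //.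
  have := cvgA_star xy; rewrite (_ : (fun n => star _) = sqrt_iter x)//.
  by apply/funext => n; exact: sqrt_iter_star.
- rewrite cmulBl !cmulBr !cmul1l !cmul1r.
  have -> : y ** y = y + y - x by rewrite yE; abelian.
  rewrite /x; abelian.
- have -> : cone - (cone - y) = y by abelian.
  apply: (nrm_le_lim xy); apply: nearW => n.
  by rewrite (le_trans (sqrt_iter_nrm _ a1))//; have /andP[] := sqrt_major_le n.
- move=> c ca; rewrite cmulBl cmulBr cmul1l cmul1r; congr (_ - _).
  apply: (@cvgA_unique (fun n => c ** sqrt_iter x n)) => //.
    by apply: cvgA_mul => //; exact: cvg_cst.
  rewrite (_ : (fun n => _) = fun n => sqrt_iter x n ** c).
    by apply: cvgA_mul => //; exact: cvg_cst.
  apply/funext => n; apply: sqrt_iter_comm.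
  by rewrite /x cmulBl cmulBr cmul1l cmul1r ca.
Qed.

(** Self-adjoint elements with nonnegative spectrum, expressed by the norm.
    In this form it is immediate that sums of positive elements are positive. *)
Definition pos a : Prop :=
  star a = a /\ exists t, 0 <= t /\ nrm (emb t - a) <= t.

Lemma pos_star a : pos a -> star a = a.
Proof. by case. Qed.

Lemma pos_sqrt a : pos a ->
  exists h, [/\ star h = h, pos h, h ** h = a
    & forall c, c ** a = a ** c -> c ** h = h ** c].
Proof.
move=> [sa [t [t0 ta]]].
have t1 : 0 < t + 1 by lra.
have tV : (t + 1) * (t + 1)^-1 = 1 by rewrite divff// gt_eqF.
have ta1 : nrm (cone - (t + 1)^-1%:C *: a) <= 1.
  have -> : cone - (t + 1)^-1%:C *: a = (t + 1)^-1%:C *: (emb (t + 1) - a).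
    by rewrite scalerBr scalerA -rmorphM/= mulrC tV scale1r.
  rewrite nrmZ_ge0; last by rewrite invr_ge0 ltW.
  rewrite ler_pdivrMl// mulr1.
  have -> : emb (t + 1) - a = (emb t - a) + emb 1 by rewrite embD; abelian.
  apply: (le_trans (nrmD _ _)); rewrite lerD//.
  by rewrite (le_trans (nrm_emb _))// normr1.
have [] := unit_sqrt _ ta1; first by rewrite starZr sa.
move=> h [sh hh h1 hC]; exists ((Num.sqrt (t + 1))%:C *: h); split.
- by rewrite starZr sh.
- split; first by rewrite starZr sh.
  exists (Num.sqrt (t + 1)); split; first exact: sqrtr_ge0.
  rewrite /emb -scalerBr nrmZ_ge0 ?sqrtr_ge0// -{2}[Num.sqrt _]mulr1.
  by rewrite ler_wpM2l ?sqrtr_ge0.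
- rewrite cmulZl cmulZr hh !scalerA -!rmorphM/= -expr2 sqr_sqrtr ?ltW//.
  by rewrite tV scale1r.
- by move=> c ca; rewrite cmulZl cmulZr hC// cmulZr cmulZl ca.
Qed.

(** The element u = h + i k satisfies u^* u = h^2 + k^2 = t, and h is its real
    part. *)
Lemma sum_sqr_bound h k t : 0 <= t -> star h = h -> star k = k ->
  h ** k = k ** h -> h ** h + k ** k = emb t -> nrm h ^+ 2 <= t.
Proof.
move=> t0 sh sk hk hkt; set u := h + 'i%C *: k.
have su : star u = h - 'i%C *: k.
  rewrite starD starZ sh sk -scaleNr; congr (_ + _ *: _).
  by apply/eqP; rewrite eq_complex /= oppr0 !eqxx.
have uu : star u ** u = emb t.
  rewrite su cmulBl !cmulDr -!cscaleAl -!cscaleAr scalerA hk -hkt.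
  have -> : 'i%C * 'i%C = -1 :> R[i] by rewrite -expr2 sqr_i.
  rewrite scaleN1r; abelian.
have nu : nrm u ^+ 2 <= t.
  by rewrite -nrm_star_mul uu (le_trans (nrm_emb _))// ger0_norm.
have hu : nrm h <= nrm u.
  have h2 : h = (2^-1 : R)%:C *: (u + star u).
    by rewrite su /u -[LHS]scaleC_half; congr (_ *: _); abelian.
  rewrite h2 nrmZ_ge0 ?invr_ge0//.
  by have := nrmD u (star u); rewrite nrm_star; lra.
by apply: le_trans nu; rewrite ler_sqr ?nnegrE ?nrm_ge0.
Qed.

Lemma pos_emb_sub a t : star a = a -> nrm a <= t -> pos (emb t - a).
Proof.
move=> sa ta; split; first by rewrite starB star_emb sa.
exists t; split; first exact: le_trans (nrm_ge0 a) ta.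
by have -> : emb t - (emb t - a) = a by abelian.
Qed.

(** With k^2 = t - h^2, it is [sum_sqr_bound] for k. *)
Lemma sqr_bound h t : star h = h -> nrm h ^+ 2 <= t ->
  nrm (emb t - h ** h) <= t.
Proof.
move=> sh ht; have t0 : 0 <= t by rewrite (le_trans _ ht)// sqr_ge0.
have /pos_sqrt[k [sk _ kk kC]] : pos (emb t - h ** h).
  by apply: pos_emb_sub; rewrite ?starM ?sh// (le_trans (nrmM _ _)).
rewrite -kk; apply: (le_trans (nrmM _ _)); rewrite -expr2.
apply: (sum_sqr_bound (k := h)) => //; last by rewrite kk; abelian.
by apply/esym/kC; rewrite cmulBl cmulBr mul_emb emb_mul cmulA.
Qed.

Lemma pos_sqr h : star h = h -> pos (h ** h).
Proof.
move=> sh; split; first by rewrite starM sh.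
by exists (nrm h ^+ 2); split; [exact: sqr_ge0|exact: sqr_bound].
Qed.

(** Any bound of the norm may serve as the witness in [pos]: this makes
    positivity stable under limits. *)
Lemma pos_bound a t : pos a -> nrm a <= t -> nrm (emb t - a) <= t.
Proof.
move=> pa at_; have [h [sh _ hh hC]] := pos_sqrt pa.
have t0 : 0 <= t by rewrite (le_trans _ at_)// nrm_ge0.
have /pos_sqrt[k [sk _ kk kC]] := pos_emb_sub (pos_star pa) at_.
rewrite -kk; apply: (le_trans (nrmM _ _)); rewrite -expr2.
apply: (sum_sqr_bound (k := h)) => //; last by rewrite kk hh; abelian.
by apply/esym/kC; rewrite cmulBl cmulBr mul_emb emb_mul -hh cmulA.
Qed.

(** Both elements have square roots, and these commute; conclude by
    [sum_sqr_bound]. *)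
Lemma pos_nrm_le a t : 0 <= t -> pos a -> pos (emb t - a) -> nrm a <= t.
Proof.
move=> t0 pa /pos_sqrt[k [sk _ kk kC]]; have [h [sh _ hh hC]] := pos_sqrt pa.
rewrite -hh; apply: (le_trans (nrmM _ _)); rewrite -expr2.
apply: (sum_sqr_bound (k := k)) => //; last by rewrite kk hh; abelian.
by apply: kC; rewrite cmulBl cmulBr mul_emb emb_mul -hh cmulA.
Qed.

Lemma pos0 : pos (0 : A).
Proof.
split; first exact: star0.
by exists 0; split=> //; rewrite /emb scale0r subr0 nrm0.
Qed.

Lemma posD a b : pos a -> pos b -> pos (a + b).
Proof.
move=> [sa [s [s0 sa']]] [sb [t [t0 tb]]]; split; first by rewrite starD sa sb.
exists (s + t); split; first exact: addr_ge0.
have -> : emb (s + t) - (a + b) = (emb s - a) + (emb t - b).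
  by rewrite embD; abelian.
by rewrite (le_trans (nrmD _ _))// lerD.
Qed.

Lemma posZ s a : 0 <= s -> pos a -> pos (s%:C *: a).
Proof.
move=> s0 [sa [t [t0 ta]]]; split; first by rewrite starZr sa.
exists (s * t); split; first exact: mulr_ge0.
have -> : emb (s * t) - s%:C *: a = s%:C *: (emb t - a).
  by rewrite scalerBr /emb scalerA -rmorphM.
by rewrite nrmZ_ge0// ler_wpM2l.
Qed.

Lemma pos_sum (I : Type) (r : seq I) (F : I -> A) :
  (forall i, pos (F i)) -> pos (\sum_(i <- r) F i).
Proof. by move=> pF; apply: big_ind => //; [exact: pos0|exact: posD]. Qed.

Lemma pos_mono a b : pos a -> pos (b - a) -> nrm a <= nrm b.
Proof.
move=> pa pba; apply: pos_nrm_le; [exact: nrm_ge0|by []|].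
have -> : emb (nrm b) - a = (emb (nrm b) - b) + (b - a) by abelian.
apply: posD => //; apply: pos_emb_sub => //.
have -> : b = (b - a) + a by abelian.
by rewrite starD !pos_star.
Qed.

Fixpoint cpow a n : A := if n is n'.+1 then cpow a n' ** a else cone.

Lemma cpowD a m n : cpow a (m + n) = cpow a m ** cpow a n.
Proof.
by elim: n => [|n IH]; rewrite ?addn0 ?addnS /= ?cmul1r// IH cmulA.
Qed.

Lemma star_cpow a n : star a = a -> star (cpow a n) = cpow a n.
Proof.
move=> sa; elim: n => [|n IH] /=; first exact: star1.
by rewrite starM IH sa; have /= := cpowD a 1 n; rewrite cmul1l.
Qed.

Lemma nrm_cpow2 a (k : nat) : star a = a ->
  nrm (cpow a (2 ^ k)) = nrm a ^+ (2 ^ k).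
Proof.
move=> sa; elim: k => [|k IH]; first by rewrite /= cmul1l.
rewrite expnS mul2n -addnn cpowD -{1}(star_cpow _ sa) nrm_star_mul IH.
by rewrite -exprM muln2 -addnn.
Qed.

Lemma nrm_cpow a t n : nrm a <= t -> nrm (cpow a n) <= t ^+ n.
Proof.
move=> at_; elim: n => [|n IH] /=; first exact: nrm1.
by rewrite (le_trans (nrmM _ _))// exprSr ler_pM// nrm_ge0.
Qed.

Lemma bernoulli (d : R) n : 0 <= d -> 1 + n%:R * d <= (1 + d) ^+ n.
Proof.
move=> d0; elim: n => [|n IH]; first by rewrite mul0r addr0 expr0.
rewrite exprSr; have d1 : 0 <= 1 + d by lra.
apply: le_trans (ler_wpM2r d1 IH); rewrite -natr1.
by have : 0 <= n%:R * (d * d); [rewrite !mulr_ge0|nra].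
Qed.

(** A polynomial factor does not affect the exponential growth rate.  Powers of
    two suffice. *)
Lemma root_test (v t : R) : 0 <= v -> 0 < t ->
  (forall k : nat, v ^+ (2 ^ k) <= (2 ^ k).+1%:R * t ^+ (2 ^ k)) -> v <= t.
Proof.
move=> v0 t0 vt; rewrite leNgt; apply/negP => tv.
pose d := v / t - 1; have d0 : 0 < d by rewrite subr_gt0 ltr_pdivlMr ?mul1r.
have dE : v / t = 1 + d by rewrite /d; ring.
(* If v / t = 1 + d with d > 0, then (1 + d)^(2 N) >= (1 + N d)^2 exceeds
   2 N + 1 as soon as N d^2 > 2. *)
have [k kd] : exists k : nat, 2 < (2 ^ k)%:R * (d * d).
  have d20 : 0 < d * d by rewrite mulr_gt0.
  exists (Num.bound (2 / (d * d))); rewrite -ltr_pdivrMr//.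
  apply: (lt_le_trans (archi_boundP _)); first by rewrite divr_ge0// ltW.
  by rewrite ler_nat ltnW// ltn_expl.
have := vt k.+1; rewrite -ler_pdivrMr ?exprn_gt0// -expr_div_n dE.
rewrite expnS mulnC exprM.
have := bernoulli (2 ^ k) (ltW d0); set N := (2 ^ k)%N in kd *.
rewrite -natr1 natrM => h1 h2.
have N0 : 0 <= N%:R :> R by [].
have : (1 + N%:R * d) ^+ 2 <= N%:R * 2 + 1.
  by apply: le_trans h2; rewrite ler_sqr ?nnegrE//; nra.
have : 2 * N%:R <= N%:R * (N%:R * (d * d)) by nra.
by rewrite expr2; nra.
Qed.

(** Let a = x^* x and b = x x^*, where -a is positive.  First b is positive,
    as the sum of -a and of twice the squares of the real and imaginary parts
    of x.  Next, u = t + b and w = t + a satisfy u x = x w; so the growth of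
    the powers of u is controlled by that of w, and |w| <= t gives |u| <= t.
    Then -b is positive too, and b = 0. *)
Lemma neg_star_mul (x : A) : pos (- (star x ** x)) -> x = 0.
Proof.
move=> pa; set a := star x ** x in pa; set b := x ** star x.
have sa : star a = a by rewrite /a starM starK.
have sb : star b = b by rewrite /b starM starK.
have [x0|x0] := leP (nrm x) 0; first exact: nrm0_eq0.
pose t := nrm x ^+ 2; have t0 : 0 < t by rewrite exprn_gt0.
(* Here p and q are, up to sign, twice the real and the imaginary part of x. *)
have pb : pos b.
  pose p := x + star x; pose q := 'i%C *: (x - star x).
  have sp : star p = p by rewrite /p starD starK addrC.
  have sq : star q = q.
    rewrite /q starZ starB starK.
    have -> : Num.conj 'i%C = - 'i%C :> R[i].
      by apply/eqP; rewrite eq_complex /= oppr0 !eqxx.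
    by rewrite scaleNr -scalerN opprB.
  have -> : b = (2^-1 : R)%:C *: (p ** p + q ** q + (- a) + (- a)).
    have -> : q ** q = - ((x - star x) ** (x - star x)).
      rewrite /q -!cscaleAl -!cscaleAr scalerA -expr2 sqr_i.
      by rewrite scaleN1r.
    rewrite -[LHS]scaleC_half; congr (_ *: _).
    rewrite /p !cmulBl !cmulDl !cmulBr !cmulDr -/a -/b; abelian.
  apply: posZ; first by rewrite invr_ge0.
  by do 3?[apply: posD] => //; exact: pos_sqr.
pose w := emb t + a; pose u := emb t + b.
have wt : nrm w <= t.
  have -> : w = emb t - (- a) by rewrite /w; abelian.
  by apply: pos_bound => //; rewrite nrmN nrm_star_mul.
have ux : u ** x = x ** w.
  by rewrite /u /w cmulDl cmulDr emb_mul mul_emb /a /b cmulA.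
(* Powers of u: u^(n+1) = t u^n + x w^n x^*. *)
have uxn n : cpow u n ** x = x ** cpow w n.
  elim: n => [|n IH] /=; first by rewrite cmul1l cmul1r.
  by rewrite -cmulA ux cmulA IH cmulA.
have un n : nrm (cpow u n) <= n.+1%:R * t ^+ n.
  elim: n => [|n IH] /=; first by rewrite expr0 mul1r nrm1.
  rewrite {2}/u cmulDr mul_emb /b cmulA uxn.
  apply: (le_trans (nrmD _ _)); rewrite nrmZ_ge0; last exact: ltW.
  have h : nrm (x ** cpow w n ** star x) <= t ^+ n.+1.
    apply: (le_trans (nrmM _ _)); rewrite nrm_star.
    have h1 : nrm (x ** cpow w n) <= nrm x * t ^+ n.
      by rewrite (le_trans (nrmM _ _))// ler_wpM2l ?nrm_ge0 ?nrm_cpow.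
    apply: (le_trans (ler_wpM2r (nrm_ge0 x) h1)).
    by rewrite exprS /t expr2 mulrAC.
  have h2 : t * nrm (cpow u n) <= t * (n.+1%:R * t ^+ n).
    by rewrite ler_wpM2l// ltW.
  apply: (le_trans (lerD h2 h)).
  by rewrite -[n.+2%:R]natr1 mulrDl mul1r exprS mulrCA.
have ut : nrm u <= t.
  apply: root_test => //; first exact: nrm_ge0.
  move=> k; rewrite -nrm_cpow2; first exact: un.
  by rewrite /u starD star_emb sb.
have b0 : b = 0.
  apply: nrm0_eq0; apply: pos_nrm_le => //.
  have -> : emb 0 - b = - b by rewrite /emb scale0r sub0r.
  split; first by rewrite starN sb.
  by exists t; split; [exact: ltW|rewrite opprK].
have := nrm_mul_star x; rewrite -/b b0 nrm0 => /esym/eqP.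
by rewrite gt_eqF.
Qed.

(** Let a = c^* c, p = |a| the square root of a^2, and n = p - a, which is
    twice the negative part of a.  Then (c n)^* (c n) = n a n = - p n^2 is the
    opposite of a square, so c n = 0 by [neg_star_mul]; this forces n^3 = 0,
    whence n = 0 and a = p. *)
Lemma pos_star_mul (c : A) : pos (star c ** c).
Proof.
set a := star c ** c; have sa : star a = a by rewrite /a starM starK.
have [p [sp pp ppa pC]] := pos_sqrt (pos_sqr sa).
have ap : a ** p = p ** a by apply: pC; rewrite cmulA.
(* The root q of p exhibits p n^2 as the square of q n. *)
have [q [sq _ qqp qC]] := pos_sqrt pp.
have aq : a ** q = q ** a by exact: qC.
have pq : p ** q = q ** p by exact: qC.
pose n := p - a; have sn : star n = n by rewrite /n starB sp sa.
have nq : n ** q = q ** n by rewrite /n cmulBl cmulBr pq aq.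
have an : a ** n = - (p ** n).
  by rewrite /n !cmulBr ppa ap opprB.
have npn : - (star (c ** n) ** (c ** n)) = (q ** n) ** (q ** n).
  rewrite starM sn -!cmulA (cmulA (star c)) -/a an cmulNr opprK.
  by rewrite -qqp -!cmulA (cmulA n q) nq !cmulA.
have d0 : c ** n = 0.
  by apply: neg_star_mul; rewrite npn; apply: pos_sqr; rewrite starM sq sn nq.
have nan : n ** a ** n = 0.
  by rewrite /a cmulA -cmulA d0 cmul0r.
have npn0 : n ** p ** n = 0.
  by rewrite -cmulA -[p ** n]opprK -an cmulNr cmulA nan oppr0.
have nn : n ** n = 0.
  apply: nrm0_eq0; rewrite -(@ler_sqr _ _ 0) ?nnegrE ?nrm_ge0//.
  rewrite -nrm_star_mul starM sn cmulA.
  have -> : n ** n ** n = 0.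
    by rewrite {2}/n cmulBr cmulBl nan npn0 subr0.
  by rewrite cmul0l nrm0 expr0n.
have n0 : n = 0.
  apply: nrm0_eq0; rewrite -(@ler_sqr _ _ 0) ?nnegrE ?nrm_ge0//.
  by rewrite -nrm_star_mul sn nn nrm0 expr0n.
have -> : a = p - n by rewrite /n; abelian.
by rewrite n0 subr0.
Qed.

Lemma pos_mul_star (c : A) : pos (c ** star c).
Proof. by have := pos_star_mul (star c); rewrite starK. Qed.

Lemma pos_conj a b : pos a -> pos (b ** a ** star b).
Proof.
move=> /pos_sqrt[h [sh _ <- _]].
have -> : b ** (h ** h) ** star b = (b ** h) ** star (b ** h).
  by rewrite starM sh !cmulA.
exact: pos_mul_star.
Qed.

Lemma pos_cstar_le a b : cstar_le a b -> pos (b - a).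
Proof. by move=> [c ->]; exact: pos_star_mul. Qed.

Lemma pos_lim (u : nat -> A) (l : A) :
  u @ \oo --> l -> (\forall n \near \oo, pos (u n)) -> pos l.
Proof.
move=> ul up.
have sl : star l = l.
  apply: (cvgA_unique (u := u)) => //.
  apply: cvg_trans (cvgA_star ul); apply: near_eq_cvg.
  by apply: filterS up => n /pos_star.
split=> //; exists (nrm l + 1); split; first by rewrite addr_ge0 ?nrm_ge0.
apply: (@nrm_le_lim (fun n => emb (nrm l + 1) - u n)).
  by apply: cvgB => //; exact: cvg_cst.
have /cvgA/(_ 1 ltr01) u1 := ul.
apply: filterS2 u1 up => n n1 pn; apply: pos_bound => //.
have -> : u n = l + (u n - l) by abelian.
by rewrite (le_trans (nrmD _ _))// lerD2l ltW.
Qed.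

End Positivity.

(** * The Hilbert module of square-summable sequences *)

Section HilbertModule.
Context {R : realType} {A : cstarAlgType R}.
Implicit Types (a b c : A) (s t e : R) (x y z : nat -> A).

(** Here p, q and s stand for <x, x>, <y, y> and <x, y>, and the hypothesis is
    the positivity of <x - b y, x - b y>.  The lemma serves for finite sums,
    before any series is known to converge, and then for the inner product of
    H_A.  As q need not be invertible, the optimal b = s q^-1 is replaced with
    b = s / T for T slightly above |q|. *)
Lemma gram_cauchy_schwarz (p q s : A) :
  (forall b, pos (p - b ** star s - s ** star b + b ** q ** star b)) ->
  pos q -> nrm s ^+ 2 <= nrm p * nrm q.
Proof.
move=> H pq; apply/ler_addgt0Pr => e e0.
have p0 := nrm_ge0 p; have q0 := nrm_ge0 q.
pose d := e / (nrm p + 1).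
have d0 : 0 < d by rewrite divr_gt0//; lra.
pose T := nrm q + d; have T0 : 0 < T by rewrite /T; lra.
have TV : T * T^-1 = 1 by rewrite divff// gt_eqF.
have pT : pos (p - T^-1%:C *: (s ** star s)).
  have := H (T^-1%:C *: s).
  rewrite starZr !cmulZl !cmulZr scalerA -rmorphM /= => H1.
  have /(pos_conj s) : pos (emb T - q).
    by apply: pos_emb_sub; [exact: pos_star|rewrite /T; lra].
  have T20 : 0 <= T^-1 * T^-1 by rewrite mulr_ge0// invr_ge0 ltW.
  move=> /(posZ T20)/(posD H1).
  rewrite cmulBr cmulBl mul_emb cmulZl scalerBr scalerA -rmorphM /=.
  have -> : T^-1 * T^-1 * T = T^-1 by rewrite -mulrA [_^-1 * T]mulrC TV mulr1.
  by congr pos; abelian.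
have pss : pos (T^-1%:C *: (s ** star s)).
  by apply: posZ; [rewrite invr_ge0 ltW|exact: pos_mul_star].
have := pos_mono pss pT.
rewrite nrmZ_ge0; last by rewrite invr_ge0 ltW.
rewrite nrm_mul_star ler_pdivrMl// => h; apply: (le_trans h).
rewrite /T mulrDl mulrC lerD2l.
by rewrite /d mulrAC ler_pdivrMr; [nra|lra].
Qed.

Lemma gram_minkowski (p q s : A) : nrm s ^+ 2 <= nrm p * nrm q ->
  Num.sqrt (nrm (p + s + star s + q)) <=
  Num.sqrt (nrm p) + Num.sqrt (nrm q).
Proof.
move=> H; rewrite -ler_sqr ?nnegrE ?addr_ge0 ?sqrtr_ge0//.
rewrite sqrrD !sqr_sqrtr ?nrm_ge0//.
have hs : nrm s <= Num.sqrt (nrm p) * Num.sqrt (nrm q).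
  rewrite -ler_sqr ?nnegrE ?mulr_ge0 ?sqrtr_ge0 ?nrm_ge0//.
  by rewrite exprMn !sqr_sqrtr ?nrm_ge0.
have := nrmD (p + s + star s) q; have := nrmD (p + s) (star s).
have := nrmD p s; rewrite nrm_star mulr2n; lra.
Qed.

(** Inner product and norm on a segment of coordinates: finite sums, which need
    no convergence. *)
Definition sip (k l : nat) x y : A := \sum_(k <= i < l) x i ** star (y i).
Definition seg (k l : nat) x : R := Num.sqrt (nrm (sip k l x x)).

Lemma sip_star k l x y : star (sip k l x y) = sip k l y x.
Proof. by rewrite star_sum; apply: eq_bigr => i _; rewrite starM starK. Qed.

Lemma sipDl k l x y z : sip k l (x + y) z = sip k l x z + sip k l y z.
Proof. by rewrite -big_split; apply: eq_bigr => i _; rewrite /= -cmulDl. Qed.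

Lemma sipDr k l x y z : sip k l z (x + y) = sip k l z x + sip k l z y.
Proof. by rewrite -sip_star sipDl starD !sip_star. Qed.

Lemma sip_actl k l a x y : sip k l (hact a x) y = a ** sip k l x y.
Proof. by rewrite cmul_sumr; apply: eq_bigr => i _; rewrite -cmulA. Qed.

Lemma sip_actr k l a x y : sip k l x (hact a y) = sip k l x y ** star a.
Proof. by rewrite -sip_star sip_actl starM sip_star. Qed.

Lemma sipNl k l x y : sip k l (- x) y = - sip k l x y.
Proof. by rewrite -sumrN; apply: eq_bigr => i _; rewrite -cmulNl. Qed.

Lemma sipNr k l x y : sip k l x (- y) = - sip k l x y.
Proof. by rewrite -sip_star sipNl starN sip_star. Qed.

Lemma pos_sip k l x : pos (sip k l x x).
Proof. by apply: pos_sum => i; exact: pos_mul_star. Qed.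

Lemma sip_cat k l m x y : (k <= l <= m)%N ->
  sip k m x y = sip k l x y + sip l m x y.
Proof. by move=> /andP[kl lm]; rewrite /sip (@big_cat_nat _ _ _ l). Qed.

Lemma seg_ge0 k l x : 0 <= seg k l x.
Proof. exact: sqrtr_ge0. Qed.

Lemma seg_sqr k l x : seg k l x ^+ 2 = nrm (sip k l x x).
Proof. by rewrite sqr_sqrtr ?nrm_ge0. Qed.

Lemma sip_cauchy_schwarz_sqr k l x y :
  nrm (sip k l x y) ^+ 2 <= nrm (sip k l x x) * nrm (sip k l y y).
Proof.
apply: gram_cauchy_schwarz; last exact: pos_sip.
move=> b; have := pos_sip k l (x - hact b y).
rewrite sipDl !sipDr !(sipNl, sipNr) !(sip_actl, sip_actr) sip_star opprK.
by congr pos; rewrite cmulA; abelian.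
Qed.

Lemma sip_cauchy_schwarz k l x y :
  nrm (sip k l x y) <= seg k l x * seg k l y.
Proof.
rewrite -ler_sqr ?nnegrE ?mulr_ge0 ?seg_ge0 ?nrm_ge0//.
by rewrite exprMn !seg_sqr sip_cauchy_schwarz_sqr.
Qed.

Lemma segD k l x y : seg k l (x + y) <= seg k l x + seg k l y.
Proof.
have := gram_minkowski (sip_cauchy_schwarz_sqr k l x y).
by congr (Num.sqrt (nrm _) <= _); rewrite sipDl !sipDr sip_star; abelian.
Qed.

Lemma segN k l x : seg k l (- x) = seg k l x.
Proof. by rewrite /seg sipNl sipNr opprK. Qed.

Lemma seg_act k l a x : seg k l (hact a x) <= nrm a * seg k l x.
Proof.
rewrite -ler_sqr ?nnegrE ?mulr_ge0 ?seg_ge0 ?nrm_ge0//.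
rewrite exprMn !seg_sqr sip_actl sip_actr.
apply: (le_trans (nrmM _ _)); rewrite expr2 -mulrA ler_wpM2l ?nrm_ge0//.
by rewrite mulrC -(nrm_star a) nrmM.
Qed.

Lemma seg_sub k l k' l' x : (k' <= k)%N -> (l <= l')%N ->
  seg k l x <= seg k' l' x.
Proof.
move=> k'k ll'; rewrite /seg ler_wsqrtr//.
have [kl|lk] := leqP k l; last first.
  by rewrite {1}/sip big_geq ?nrm0 ?nrm_ge0// ltnW.
apply: pos_mono; first exact: pos_sip.
rewrite (@sip_cat k' k) ?k'k ?(leq_trans kl)//.
rewrite (@sip_cat k l) ?kl//.
have -> : sip k' k x x + (sip k l x x + sip l l' x x) - sip k l x x =
  sip k' k x x + sip l l' x x by abelian.
by apply: posD; exact: pos_sip.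
Qed.

Lemma seg1 k x : seg k k.+1 x = nrm (x k).
Proof.
by rewrite /seg /sip big_nat1 nrm_mul_star sqrtr_sqr ger0_norm ?nrm_ge0.
Qed.

Lemma series_sub (f : nat -> A) k l : (k <= l)%N ->
  series f l - series f k = \sum_(k <= i < l) f i.
Proof.
move=> kl; rewrite /series /= (@big_cat_nat _ _ _ k 0%N l)//=.
by rewrite addrAC subrr add0r.
Qed.

(** The Cauchy criterion; in this form, membership in [HA] can be handled with
    the triangle inequality for [seg]. *)
Lemma HA_seg x : HA x <->
  (forall e, 0 < e -> exists N, forall k l, (N <= k <= l)%N -> seg k l x < e).
Proof.
split=> [xc e e0|H].
- have e20 : 0 < e ^+ 2 / 2 by rewrite divr_gt0 ?exprn_gt0.
  have /cvgA/(_ _ e20)[N _ HN] : series (fun i => x i ** star (x i)) @ \oo -->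
    limn (series (fun i => x i ** star (x i))) by exact: xc.
  exists N => k l /andP[Nk kl].
  rewrite -ltr_sqr ?nnegrE ?seg_ge0 ?(ltW e0)//.
  rewrite seg_sqr /sip -series_sub//.
  set L := limn _ in HN.
  set u := series _ in HN *.
  have -> : u l - u k = (u l - L) - (u k - L) by abelian.
  apply: (le_lt_trans (nrmB _ _)).
  by have := HN _ Nk; have := HN _ (leq_trans Nk kl); rewrite /=; lra.
- suff [l] : exists l : A, series (fun i => x i ** star (x i)) @ \oo --> l.
    by move=> /cvgP.
  apply: cauchyA => e e0; have se0 : 0 < Num.sqrt e by rewrite sqrtr_gt0.
  have [N HN] := H _ se0.
  exists N => m n /andP[Nm mn].
  rewrite series_sub// -/(sip m n x x) -seg_sqr -[e]sqr_sqrtr ?ltW//.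
  by rewrite ltr_sqr ?nnegrE ?seg_ge0 ?sqrtr_ge0// HN// Nm.
Qed.

Lemma HA0 : HA (0 : nat -> A).
Proof.
apply/HA_seg => e e0; exists 0%N => k l _.
rewrite /seg /sip big1 ?nrm0 ?sqrtr0//.
by move=> i _; rewrite cmul0l.
Qed.

Lemma HAN x : HA x -> HA (- x).
Proof.
move=> /HA_seg H; apply/HA_seg => e /H[N HN]; exists N => k l /HN.
by rewrite segN.
Qed.

Lemma HAD x y : HA x -> HA y -> HA (x + y).
Proof.
move=> /HA_seg Hx /HA_seg Hy; apply/HA_seg => e e0.
have e20 : 0 < e / 2 by lra.
have [N HN] := Hx _ e20; have [M HM] := Hy _ e20.
exists (maxn N M) => k l /andP[]; rewrite geq_max => /andP[Nk Mk] kl.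
apply: (le_lt_trans (segD _ _ _ _)).
by have := HN k l; have := HM k l; rewrite Nk Mk kl => /(_ isT) + /(_ isT); lra.
Qed.

Lemma HAB x y : HA x -> HA y -> HA (x - y).
Proof. by move=> hx hy; apply: HAD => //; exact: HAN. Qed.

Lemma HAact a x : HA x -> HA (hact a x).
Proof.
move=> /HA_seg H; apply/HA_seg => e e0.
have a0 := nrm_ge0 a.
have e10 : 0 < e / (nrm a + 1) by rewrite divr_gt0//; lra.
have [N HN] := H _ e10; exists N => k l /HN h.
apply: (le_lt_trans (seg_act _ _ _ _)).
have := seg_ge0 k l x; move: h; rewrite ltr_pdivlMr; last lra.
by nra.
Qed.

(* Membership in HA unfolds to an implication, which would make every argument
   implicit. *)
Arguments HAact a [x] _.

Lemma HA_sum (I : Type) (r : seq I) (F : I -> nat -> A) :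
  (forall i, HA (F i)) -> HA (\sum_(i <- r) F i).
Proof. by move=> HF; apply: big_ind => //; [exact: HA0|exact: HAD]. Qed.

Lemma hip_cvg x y : HA x -> HA y ->
  series (fun i => x i ** star (y i)) @ \oo --> hip x y.
Proof.
move=> /HA_seg Hx /HA_seg Hy.
suff [l] : exists l : A, series (fun i => x i ** star (y i)) @ \oo --> l.
  by move=> /cvgP.
apply: cauchyA => e e0.
have [N HN] := Hx _ ltr01; have [M HM] := Hy _ e0.
exists (maxn N M) => k l /andP[]; rewrite geq_max => /andP[Nk Mk] kl.
rewrite series_sub//; apply: (le_lt_trans (sip_cauchy_schwarz _ _ _ _)).
have := HN k l; have := HM k l; rewrite Nk Mk kl => /(_ isT) + /(_ isT).
by have := seg_ge0 k l x; have := seg_ge0 k l y; nra.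
Qed.

Lemma hip_cvgE x y (l : A) : series (fun i => x i ** star (y i)) @ \oo --> l ->
  hip x y = l.
Proof.
move=> h; apply: (cvgA_unique (u := series (fun i => x i ** star (y i)))) => //.
exact: (cvgP _ h).
Qed.

Lemma star_hip x y : HA x -> HA y -> star (hip x y) = hip y x.
Proof.
move=> hx hy; apply/esym/hip_cvgE; have := cvgA_star (hip_cvg hx hy).
rewrite (_ : (fun n => _) = series (fun i => y i ** star (x i)))//.
by apply/funext => n; exact: sip_star.
Qed.

Lemma hipDl x y z : HA x -> HA y -> HA z -> hip (x + y) z = hip x z + hip y z.
Proof.
move=> hx hy hz; apply: hip_cvgE.
rewrite (_ : series _ = fun n => series (fun i => x i ** star (z i)) n +
  series (fun i => y i ** star (z i)) n).
  by apply: cvgD; exact: hip_cvg.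
by apply/funext => n; exact: sipDl.
Qed.

Lemma hip_actl a x y : HA x -> HA y -> hip (hact a x) y = a ** hip x y.
Proof.
move=> hx hy; apply: hip_cvgE.
rewrite (_ : series _ = fun n => a ** series (fun i => x i ** star (y i)) n).
  by apply: cvgA_mul; [exact: cvg_cst|exact: hip_cvg].
by apply/funext => n; exact: sip_actl.
Qed.

Lemma hipNl x y : HA x -> HA y -> hip (- x) y = - hip x y.
Proof.
move=> hx hy; apply: hip_cvgE.
rewrite (_ : series _ = fun n => - series (fun i => x i ** star (y i)) n).
  by apply: cvgN; exact: hip_cvg.
by apply/funext => n; exact: sipNl.
Qed.

Lemma hipDr x y z : HA x -> HA y -> HA z -> hip z (x + y) = hip z x + hip z y.
Proof.
move=> hx hy hz; have hxy := HAD hx hy.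
by rewrite -star_hip// hipDl// starD !star_hip.
Qed.

Lemma hipNr x y : HA x -> HA y -> hip x (- y) = - hip x y.
Proof.
move=> hx hy; have hy' := HAN hy.
by rewrite -star_hip// hipNl// starN star_hip.
Qed.

Lemma hip_actr a x y : HA x -> HA y -> hip x (hact a y) = hip x y ** star a.
Proof.
move=> hx hy; have hy' := HAact a hy.
by rewrite -star_hip// hip_actl// starM star_hip.
Qed.

Lemma hipBl x y z : HA x -> HA y -> HA z -> hip (x - y) z = hip x z - hip y z.
Proof. by move=> hx hy hz; have hy' := HAN hy; rewrite hipDl// hipNl. Qed.

Lemma hipBr x y z : HA x -> HA y -> HA z -> hip z (x - y) = hip z x - hip z y.
Proof. by move=> hx hy hz; have hy' := HAN hy; rewrite hipDr// hipNr. Qed.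

Lemma hip0l y : hip 0 y = 0.
Proof.
apply: hip_cvgE; rewrite (_ : series _ = fun=> 0); first exact: cvg_cst.
by apply/funext => n; rewrite /series /= big1// => i _; rewrite cmul0l.
Qed.

Lemma hip_suml (I : Type) (r : seq I) (F : I -> nat -> A) y :
  (forall i, HA (F i)) -> HA y ->
  hip (\sum_(i <- r) F i) y = \sum_(i <- r) hip (F i) y.
Proof.
move=> HF hy; elim: r => [|i r IH]; rewrite ?big_nil ?hip0l// !big_cons.
by rewrite hipDl ?IH//; exact: HA_sum.
Qed.

Lemma pos_hip x : HA x -> pos (hip x x).
Proof.
move=> hx; apply: (pos_lim (hip_cvg hx hx)); apply: nearW => n.
exact: pos_sip.
Qed.

Lemma hnorm_ge0 x : 0 <= hnorm x.
Proof. exact: sqrtr_ge0. Qed.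

Lemma hnorm_sqr x : hnorm x ^+ 2 = nrm (hip x x).
Proof. by rewrite sqr_sqrtr// nrm_ge0. Qed.

Lemma hip_cauchy_schwarz_sqr x y : HA x -> HA y ->
  nrm (hip x y) ^+ 2 <= nrm (hip x x) * nrm (hip y y).
Proof.
move=> hx hy; apply: gram_cauchy_schwarz; last exact: pos_hip.
move=> b; have hby := HAact b hy; have := pos_hip (HAB hx hby).
rewrite hipBl ?hipBr//; last exact: HAB.
rewrite !hip_actl ?hip_actr// star_hip//.
by congr pos; rewrite cmulA; abelian.
Qed.

Lemma hip_cauchy_schwarz x y : HA x -> HA y ->
  nrm (hip x y) <= hnorm x * hnorm y.
Proof.
move=> hx hy; rewrite -ler_sqr ?nnegrE ?mulr_ge0 ?hnorm_ge0 ?nrm_ge0//.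
by rewrite exprMn !hnorm_sqr hip_cauchy_schwarz_sqr.
Qed.

Lemma hnorm_add x y : HA x -> HA y -> hnorm (x + y) <= hnorm x + hnorm y.
Proof.
move=> hx hy; have hxy := HAD hx hy.
have := gram_minkowski (hip_cauchy_schwarz_sqr hx hy).
congr (Num.sqrt (nrm _) <= _).
by rewrite hipDl ?hipDr// star_hip//; abelian.
Qed.

Lemma hnorm_opp x : HA x -> hnorm (- x) = hnorm x.
Proof.
by move=> hx; have hx' := HAN hx; rewrite /hnorm hipNl ?hipNr ?opprK.
Qed.

Lemma hnorm_sub x y : HA x -> HA y -> hnorm (x - y) <= hnorm x + hnorm y.
Proof.
by move=> hx hy; rewrite (le_trans (hnorm_add _ _))// ?hnorm_opp//; exact: HAN.
Qed.

Lemma hnorm_distC x y : HA x -> HA y -> hnorm (x - y) = hnorm (y - x).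
Proof. by move=> hx hy; rewrite -hnorm_opp ?opprB//; exact: HAB. Qed.

Lemma hnorm0 : hnorm (0 : nat -> A) = 0.
Proof. by rewrite /hnorm hip0l -/(nrm 0) nrm0 sqrtr0. Qed.

Lemma hnorm_act a x : HA x -> hnorm (hact a x) <= nrm a * hnorm x.
Proof.
move=> hx; have hax := HAact a hx.
rewrite -ler_sqr ?nnegrE ?mulr_ge0 ?hnorm_ge0 ?nrm_ge0//.
rewrite exprMn !hnorm_sqr hip_actl// hip_actr//.
apply: (le_trans (nrmM _ _)); rewrite expr2 -mulrA ler_wpM2l ?nrm_ge0//.
by rewrite mulrC -(nrm_star a) nrmM.
Qed.

Lemma seg_le_hnorm k l x : HA x -> seg k l x <= hnorm x.
Proof.
move=> hx; rewrite /seg /hnorm -/(nrm _) ler_wsqrtr//.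
apply: (@le_trans _ _ (nrm (sip 0 l x x))).
  by rewrite -!seg_sqr ler_sqr ?nnegrE ?seg_ge0// seg_sub.
apply: pos_mono; first exact: pos_sip.
apply: (@pos_lim _ _
  (fun n => series (fun i => x i ** star (x i)) n - sip 0 l x x)).
  by apply: cvgB; [exact: hip_cvg|exact: cvg_cst].
exists l => // n /= ln.
have -> : series (fun i => x i ** star (x i)) n - sip 0 l x x = sip l n x x.
  exact: series_sub.
exact: pos_sip.
Qed.

Lemma coord_le_hnorm i x : HA x -> nrm (x i) <= hnorm x.
Proof. by move=> hx; rewrite -seg1 seg_le_hnorm. Qed.

Lemma hnorm_le_seg x t : 0 <= t -> HA x -> (forall l, seg 0 l x <= t) ->
  hnorm x <= t.
Proof.
move=> t0 hx xt; rewrite -ler_sqr ?nnegrE ?hnorm_ge0// hnorm_sqr.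
apply: (nrm_le_lim (hip_cvg hx hx)); apply: nearW => n.
by rewrite -[X in nrm X]/(sip 0 n x x) -seg_sqr ler_sqr ?nnegrE ?seg_ge0.
Qed.

Lemma hnorm0_eq0 x : HA x -> hnorm x <= 0 -> x = 0.
Proof.
move=> hx x0; apply/funext => i; apply: nrm0_eq0.
exact: le_trans (coord_le_hnorm i hx) x0.
Qed.

Lemma hip0_eq0 x : HA x -> hip x x = 0 -> x = 0.
Proof.
move=> hx x0; apply: hnorm0_eq0 => //.
by rewrite /hnorm -/(nrm _) x0 nrm0 sqrtr0.
Qed.

Lemma hcvgP (u : nat -> nat -> A) x : hcvg u x <->
  (forall e, 0 < e -> \forall n \near \oo, hnorm (u n - x) < e).
Proof.
rewrite /hcvg; split=> [/cvgrPdist_lt H e /H|H].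
  by apply: filterS => n; rewrite sub0r normrN ger0_norm// hnorm_ge0.
apply/cvgrPdist_lt => e /H; apply: filterS => n.
by rewrite sub0r normrN ger0_norm// hnorm_ge0.
Qed.

Lemma HA_complete (u : nat -> nat -> A) : (forall n, HA (u n)) ->
  (forall e, 0 < e ->
    exists N, forall m n, (N <= m <= n)%N -> hnorm (u n - u m) < e) ->
  exists x, HA x /\ hcvg u x.
Proof.
move=> hu uC.
have /choice[x xu] : forall i, exists xi : A, (fun n => u n i) @ \oo --> xi.
  move=> i; apply: cauchyA => e /uC[N HN]; exists N => m n mn.
  by apply: (le_lt_trans _ (HN _ _ mn)); apply: (coord_le_hnorm i); exact: HAB.
(* Coordinatewise convergence is convergence on every finite segment. *)
have xseg l e : 0 < e -> \forall n \near \oo, seg 0 l (u n - x) < e.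
  elim: l e => [|l IH] e e0.
    by apply: nearW => n; rewrite /seg /sip big_geq// nrm0 sqrtr0.
  have e20 : 0 < e / 2 by lra.
  have /cvgA/(_ _ e20) ul := xu l.
  apply: filterS2 ul (IH _ e20) => n h1 h2.
  have h3 : seg 0 l.+1 (u n - x) <= seg 0 l (u n - x) + nrm (u n l - x l).
    rewrite -ler_sqr ?nnegrE ?addr_ge0 ?seg_ge0 ?nrm_ge0// seg_sqr.
    rewrite /sip big_nat_recr//= -/(sip 0 l _ _).
    apply: (le_trans (nrmD _ _)); rewrite nrm_mul_star -seg_sqr.
    have := seg_ge0 0 l (u n - x); have := nrm_ge0 (u n l - x l).
    by rewrite sqrrD mulr2n -[(u n - x) l]/(u n l - x l); nra.
  by lra.
(* The Cauchy bound passes to the limit, uniformly in the segment. *)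
have ux e : 0 < e -> exists N, forall n, (N <= n)%N ->
    forall k l, seg k l (u n - x) <= e.
  move=> e0; have [N HN] := uC e e0; exists N => n Nn k l.
  apply: (le_trans (@seg_sub k l 0 l _ _ _)) => //.
  apply/ler_addgt0Pr => d d0.
  have [M _ HM] := xseg l d d0.
  have := HM (maxn M n) (leq_maxl _ _); have := HN n (maxn M n).
  rewrite Nn leq_maxr => /(_ isT) /= h1 h2.
  have -> : u n - x = (u n - u (maxn M n)) + (u (maxn M n) - x) by abelian.
  apply: (le_trans (segD _ _ _ _)); apply: lerD; last exact: ltW.
  rewrite -segN opprB; apply: ltW; apply: le_lt_trans h1.
  by apply: seg_le_hnorm; exact: HAB.
have hx : HA x.
  apply/HA_seg => e e0; have e20 : 0 < e / 2 by lra.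
  have [N HN] := ux _ e20.
  have /HA_seg/(_ _ e20)[M HM] := hu N.
  exists M => k l kl.
  have -> : x = u N - (u N - x) by abelian.
  apply: (le_lt_trans (segD _ _ _ _)); rewrite segN.
  by have := HM _ _ kl; have := HN N (leqnn _) k l; lra.
exists x; split=> //; apply/hcvgP => e e0.
have e20 : 0 < e / 2 by lra.
have [N HN] := ux _ e20; exists N => // n /= Nn.
apply: (@le_lt_trans _ _ (e / 2)); last by lra.
apply: hnorm_le_seg; [by lra|exact: HAB|by move=> l; exact: HN].
Qed.

End HilbertModule.
Arguments HAact {R A} a [x] _.

(** * Closed submodules and bounded operators *)

Section Submodules.
Context {R : realType} {A : cstarAlgType R}.
Implicit Types (a b c : A) (t e C D : R) (x y z : nat -> A).
Implicit Types (M K X Y : set (nat -> A)) (u v : nat -> nat -> A).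

Lemma hactDr a x y : hact a (x + y) = hact a x + hact a y.
Proof. by apply/funext => i; rewrite /hact /= cmulDr. Qed.

Lemma hactNr a x : hact a (- x) = - hact a x.
Proof. by apply/funext => i; rewrite /hact /= cmulNr. Qed.

Lemma hactBr a x y : hact a (x - y) = hact a x - hact a y.
Proof. by rewrite hactDr hactNr. Qed.

Lemma hactDl a b x : hact (a + b) x = hact a x + hact b x.
Proof. by apply/funext => i; rewrite /hact /= cmulDl. Qed.

Lemma hactNl a x : hact (- a) x = - hact a x.
Proof. by apply/funext => i; rewrite /hact /= cmulNl. Qed.

Lemma hactA a b x : hact a (hact b x) = hact (a ** b) x.
Proof. by apply/funext => i; rewrite /hact /= cmulA. Qed.

Lemma hact1 x : hact cone x = x.
Proof. by apply/funext => i; rewrite /hact /= cmul1l. Qed.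

Lemma hact0l x : hact 0 x = 0.
Proof. by apply/funext => i; rewrite /hact /= cmul0l. Qed.

Lemma hact0r a : hact a 0 = 0.
Proof. by apply/funext => i; rewrite /hact /= cmul0r. Qed.

Lemma hact_sumr (I : Type) (r : seq I) (F : I -> nat -> A) a :
  hact a (\sum_(i <- r) F i) = \sum_(i <- r) hact a (F i).
Proof.
elim: r => [|i r IH]; rewrite ?big_nil ?hact0r// !big_cons.
by rewrite hactDr IH.
Qed.

Definition rsc t x := hact (emb t) x.

Lemma rscA (s t : R) x : rsc s (rsc t x) = rsc (s * t) x.
Proof. by rewrite /rsc hactA emb_mul /emb scalerA -rmorphM. Qed.

Lemma rsc1 x : rsc 1 x = x.
Proof. by rewrite /rsc /emb scale1r hact1. Qed.

Lemma rscK (s : R) x : s != 0 -> rsc s (rsc s^-1 x) = x.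
Proof. by move=> s0; rewrite rscA divff// rsc1. Qed.

Lemma rscVK (s : R) x : s != 0 -> rsc s^-1 (rsc s x) = x.
Proof. by move=> s0; rewrite rscA mulVf// rsc1. Qed.

Lemma hnorm_rsc t x : HA x -> hnorm (rsc t x) <= `|t| * hnorm x.
Proof.
move=> hx; apply: (le_trans (hnorm_act _ hx)).
by rewrite ler_wpM2r ?hnorm_ge0// nrm_emb.
Qed.

Section ClosedSubmodule.
Variable M : set (nat -> A).
Hypothesis cM : closed_submodule M.

Lemma csm_HA x : M x -> HA x.
Proof. by case: cM => + _ _ _ _; exact. Qed.

Lemma csm0 : M 0.
Proof. by case: cM. Qed.

Lemma csmD x y : M x -> M y -> M (x + y).
Proof. by case: cM => _ _ + _ _; exact. Qed.

Lemma csm_act a x : M x -> M (hact a x).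
Proof. by case: cM => _ _ _ + _; exact. Qed.

Lemma csmN x : M x -> M (- x).
Proof. by move=> /(csm_act (- cone)); rewrite hactNl hact1. Qed.

Lemma csmB x y : M x -> M y -> M (x - y).
Proof. by move=> Mx /csmN; exact: csmD. Qed.

Lemma csm_sum (I : Type) (r : seq I) (F : I -> nat -> A) :
  (forall i, M (F i)) -> M (\sum_(i <- r) F i).
Proof. by move=> HF; apply: big_ind => //; [exact: csm0|exact: csmD]. Qed.

Lemma csm_lim u x : (forall n, M (u n)) -> HA x -> hcvg u x -> M x.
Proof.
move=> Mu hx /hcvgP ux; case: cM => _ _ _ _; apply; split=> // e /ux[N _ HN].
exists (u N); split=> //; rewrite hnorm_distC//; last exact: csm_HA.
exact: HN (leqnn N).
Qed.

End ClosedSubmodule.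

Lemma closed_submodule_HA : closed_submodule (@HA R A).
Proof.
by split=> //; [exact: HA0|exact: HAD|exact: HAact|move=> x []].
Qed.
Let cHA := closed_submodule_HA.

Lemma hcvg_unique u x y : (forall n, HA (u n)) -> HA x -> HA y ->
  hcvg u x -> hcvg u y -> x = y.
Proof.
move=> hu hx hy /hcvgP ux /hcvgP uy.
apply/eqP; rewrite -subr_eq0; apply/eqP/hnorm0_eq0; first exact: HAB.
apply/ler_addgt0Pr => e e0; rewrite add0r.
have e20 : 0 < e / 2 by lra.
have [n [h1 h2]] : exists n, hnorm (u n - x) < e / 2 /\ hnorm (u n - y) < e / 2.
  near \oo => n; exists n; split; near: n; [exact: ux|exact: uy].
have -> : x - y = (u n - y) - (u n - x) by abelian.
apply: (le_trans (hnorm_sub (HAB (hu n) hy) (HAB (hu n) hx))); lra.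
Unshelve. all: by end_near. Qed.

Lemma hcvgD u v x y : (forall n, HA (u n)) -> (forall n, HA (v n)) ->
  HA x -> HA y -> hcvg u x -> hcvg v y -> hcvg (fun n => u n + v n) (x + y).
Proof.
move=> hu hv hx hy /hcvgP ux /hcvgP vy; apply/hcvgP => e e0.
have e20 : 0 < e / 2 by lra.
apply: filterS2 (ux _ e20) (vy _ e20) => n h1 h2.
have -> : u n + v n - (x + y) = (u n - x) + (v n - y) by abelian.
apply: (le_lt_trans (hnorm_add (HAB (hu n) hx) (HAB (hv n) hy))); lra.
Qed.

Lemma hcvg_cst x : hcvg (fun=> x) x.
Proof.
by apply/hcvgP => e e0; apply: nearW => n; rewrite subrr hnorm0.
Qed.

Lemma hcvg_ext u v x : (forall n, u n = v n) -> hcvg u x -> hcvg v x.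
Proof. by move=> uv; have -> : u = v by apply/funext. Qed.

Lemma hcvgS u x : hcvg u x -> hcvg (fun n => u n.+1) x.
Proof.
move=> /hcvgP ux; apply/hcvgP => e /ux[N _ HN]; exists N => // n Nn.
by apply: HN; exact: leqW.
Qed.

Lemma hnorm_le_lim u x t : (forall n, HA (u n)) -> HA x -> hcvg u x ->
  (forall n, hnorm (u n) <= t) -> hnorm x <= t.
Proof.
move=> hu hx /hcvgP ux ut; apply/ler_addgt0Pr => e /ux[N _ HN].
have -> : x = u N - (u N - x) by abelian.
apply: (le_trans (hnorm_sub (hu N) (HAB (hu N) hx))).
by apply: lerD => //; apply: ltW; exact: HN (leqnn N).
Qed.

Lemma hcvg_hip u x y : (forall n, HA (u n)) -> HA x -> HA y -> hcvg u x ->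
  (fun n => hip (u n) y) @ \oo --> hip x y.
Proof.
move=> hu hx hy /hcvgP ux; apply/cvgA => e e0.
have y0 := hnorm_ge0 y.
have e10 : 0 < e / (hnorm y + 1) by rewrite divr_gt0//; lra.
apply: filterS (ux _ e10) => n h; rewrite -hipBl//.
apply: (le_lt_trans (hip_cauchy_schwarz (HAB (hu n) hx) hy)).
have := hnorm_ge0 (u n - x); move: h; rewrite ltr_pdivlMr; last lra.
by nra.
Qed.

Section BoundedOperator.
Variables (X Y : set (nat -> A)) (F : (nat -> A) -> nat -> A).
Hypotheses (cX : closed_submodule X) (bF : bounded_operator X Y F).

Lemma bop_mem x : X x -> Y (F x).
Proof. by case: bF => + _ _ _; exact. Qed.

Lemma bopD x y : X x -> X y -> F (x + y) = F x + F y.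
Proof. by case: bF => _ + _ _; exact. Qed.

Lemma bop_act a x : X x -> F (hact a x) = hact a (F x).
Proof. by case: bF => _ _ + _; exact. Qed.

Lemma bopN x : X x -> F (- x) = - F x.
Proof.
move=> Xx; have := bop_act (- cone) Xx.
by rewrite !hactNl !hact1.
Qed.

Lemma bopB x y : X x -> X y -> F (x - y) = F x - F y.
Proof. by move=> Xx Xy; rewrite bopD ?bopN//; exact: csmN. Qed.

Lemma bop0 : F 0 = 0.
Proof. by have := bop_act 0 (csm0 cX); rewrite !hact0l. Qed.

Lemma bop_sum (I : Type) (r : seq I) (G : I -> nat -> A) :
  (forall i, X (G i)) -> F (\sum_(i <- r) G i) = \sum_(i <- r) F (G i).
Proof.
move=> HG; elim: r => [|i r IH]; rewrite ?big_nil ?bop0// !big_cons.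
by rewrite bopD ?IH//; exact: csm_sum.
Qed.

Lemma bop_bound : exists C, 0 < C /\
  forall x, X x -> hnorm (F x) <= C * hnorm x.
Proof.
case: bF => _ _ _ [C HC]; exists (`|C| + 1).
split; first by have := normr_ge0 C; lra.
move=> x /HC h; apply: (le_trans h); rewrite ler_wpM2r ?hnorm_ge0//.
by have := ler_norm C; lra.
Qed.

Lemma bop_hcvg u x : (forall n, X (u n)) -> X x -> hcvg u x ->
  hcvg (fun n => F (u n)) (F x).
Proof.
move=> Xu Xx /hcvgP ux; apply/hcvgP => e e0.
have [C [C0 HC]] := bop_bound.
have eC0 : 0 < e / C by rewrite divr_gt0.
apply: filterS (ux _ eC0) => n h; rewrite -bopB//.
apply: (le_lt_trans (HC _ (csmB cX (Xu n) Xx))).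
by rewrite mulrC -ltr_pdivlMr.
Qed.

End BoundedOperator.

Lemma geometric_small C e : 0 < e ->
  exists N, forall n, (N <= n)%N -> C * 2^-1 ^+ n < e.
Proof.
move=> e0; exists (Num.bound (`|C| / e)) => n Nn.
rewrite exprVn ltr_pdivrMr ?exprn_gt0// mulrC -ltr_pdivrMr//.
apply: (@le_lt_trans _ _ (`|C| / e)).
  by rewrite ler_pM2r ?invr_gt0// ler_norm.
apply: (lt_le_trans (archi_boundP _)); first by rewrite divr_ge0// ltW.
by rewrite -natrX ler_nat (leq_trans Nn)// ltnW// ltn_expl.
Qed.

(** Completeness, in the form used by the successive approximations below. *)
Lemma geometric_series M v C : closed_submodule M -> (forall n, M (v n)) ->
  (forall n, hnorm (v n) <= C * 2^-1 ^+ n) ->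
  exists s, [/\ M s, hcvg (fun k => \sum_(n < k) v n) s & hnorm s <= 2 * C].
Proof.
move=> cM Mv vC; pose S k := \sum_(n < k) v n.
have C0 : 0 <= C.
  by have := vC 0%N; rewrite expr0 mulr1; exact/le_trans/hnorm_ge0.
have hv n : HA (v n) by exact: csm_HA (Mv n).
have hS k : HA (S k) by exact: HA_sum.
have SB k j : hnorm (S (k + j)%N - S k) <=
    2 * C * 2^-1 ^+ k - 2 * C * 2^-1 ^+ (k + j).
  elim: j => [|j IH]; first by rewrite addn0 !subrr hnorm0.
  have -> : S (k + j.+1)%N - S k = (S (k + j)%N - S k) + v (k + j)%N.
    by rewrite /S addnS big_ord_recr/=; abelian.
  apply: (le_trans (hnorm_add (HAB (hS _) (hS _)) (hv _))).
  apply: (le_trans (lerD IH (vC _))); rewrite addnS exprS; lra.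
have SC k j : hnorm (S (k + j)%N - S k) <= 2 * C * 2^-1 ^+ k.
  apply: (le_trans (SB k j)); have : 0 <= 2 * C * 2^-1 ^+ (k + j); last lra.
  by rewrite !mulr_ge0// exprn_ge0// invr_ge0.
have [s [hs Ss]] : exists s, HA s /\ hcvg S s.
  apply: HA_complete => // e e0; have [N HN] := geometric_small (2 * C) e0.
  exists N => m n /andP[Nm mn]; rewrite -(subnKC mn).
  exact: le_lt_trans (SC _ _) (HN _ Nm).
exists s; split=> //.
  by apply: (csm_lim cM _ hs Ss) => k; exact: csm_sum.
apply: (hnorm_le_lim hS hs Ss) => k.
by have := SC 0%N k; rewrite add0n {2}/S big_ord0 subr0 expr0 mulr1.
Qed.

(** Neumann series: z is the sum of the v_n, where v_0 is a preimage of y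
    under L and v_(n+1) a preimage of - E v_n, so that
    |v_(n+1)| <= |v_n| / 2. *)
Lemma surjective_perturbation Y L E C D : closed_submodule Y ->
  bounded_operator Y Y L -> bounded_operator Y Y E -> 0 <= C -> C * D <= 2^-1 ->
  (forall y, Y y -> exists z, [/\ Y z, L z = y & hnorm z <= C * hnorm y]) ->
  (forall y, Y y -> hnorm (E y) <= D * hnorm y) ->
  forall y, Y y -> exists z, Y z /\ L z + E z = y.
Proof.
move=> cY bL bE C0 CD Lsurj ED y Yy.
have /choice[G HG] : forall w, exists z, Y w ->
    [/\ Y z, L z = w & hnorm z <= C * hnorm w].
  move=> w; have [Yw|nYw] := pselect (Y w); last by exists 0.
  by have [z Hz] := Lsurj w Yw; exists z.
pose v := fix v n := if n is n'.+1 then G (- E (v n')) else G y.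
have YN w (Yw : Y w) : Y (- E w) := csmN cY (bop_mem bE Yw).
have Yv n : Y (v n).
  by elim: n => [|n IH] /=; [case: (HG y Yy)|case: (HG _ (YN _ IH))].
have YE n : Y (- E (v n)) by exact: YN.
have vC n : hnorm (v n) <= C * hnorm y * 2^-1 ^+ n.
  elim: n => [|n IH] /=; first by rewrite expr0 mulr1; case: (HG y Yy).
  case: (HG _ (YE n)) => _ _ h; apply: (le_trans h).
  rewrite hnorm_opp; last exact (csm_HA cY (bop_mem bE (Yv n))).
  apply: (@le_trans _ _ (C * (D * hnorm (v n)))).
    by rewrite ler_wpM2l// ED.
  rewrite mulrA exprS (mulrCA (C * hnorm y)).
  apply: (@le_trans _ _ (2^-1 * hnorm (v n))).
    by rewrite ler_wpM2r ?hnorm_ge0.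
  by rewrite ler_wpM2l// invr_ge0.
have [s [Ys Ss _]] := geometric_series cY Yv vC.
pose S k := \sum_(n < k) v n.
have YS k : Y (S k) by exact: csm_sum.
exists s; split=> //.
have LS k : L (S k.+1) = y - E (S k).
  rewrite /S big_ord_recl (bopD bL)//; last exact: csm_sum.
  rewrite (bop_sum cY bL)// (bop_sum cY bE)//.
  congr (_ + _); first by case: (HG y Yy).
  by rewrite -sumrN; apply: eq_bigr => i _; case: (HG _ (YE i)).
have hY w : Y w -> HA w by exact: csm_HA.
have YEs := bop_mem bE Ys; have YLs := bop_mem bL Ys.
have YLS k : Y (L (S k.+1)) by exact (bop_mem bL (YS _)).
suff -> : L s = y - E s by abelian.
apply: (@hcvg_unique (fun k => L (S k.+1))) => //.
- by move=> k; exact/hY/YLS.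
- exact: hY.
- by apply: HAB; exact: hY.
- by apply: (bop_hcvg cY bL) => //; exact: hcvgS.
- apply: (@hcvg_ext (fun k => y + E (- S k))).
    by move=> k; rewrite (bopN bE)// LS.
  rewrite -(bopN bE)//; apply: hcvgD.
  + by move=> _; exact: hY.
  + by move=> k; apply/hY/(bop_mem bE)/(csmN cY).
  + exact: hY.
  + by apply/hY/(bop_mem bE)/(csmN cY).
  + exact: hcvg_cst.
  + apply: (bop_hcvg cY bE); [by move=> k; exact: csmN|exact: csmN|].
    move/hcvgP: Ss => Ss; apply/hcvgP => e /Ss; apply: filterS => n.
    rewrite -hnorm_opp; last exact (HAB (hY _ (YS n)) (hY _ Ys)).
    by congr (hnorm _ < _); rewrite /S; abelian.
Qed.

Lemma rsc_bounded Y t : closed_submodule Y -> bounded_operator Y Y (rsc t).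
Proof.
move=> cY; split.
- by move=> x; exact: csm_act.
- by move=> x y _ _; exact: hactDr.
- move=> a x _; rewrite /rsc !hactA; congr hact.
  by rewrite emb_mul mul_emb.
- by exists `|t| => x /(csm_HA cY); exact: hnorm_rsc.
Qed.

Lemma bounded_operatorD X Y F G : closed_submodule X -> closed_submodule Y ->
  bounded_operator X Y F -> bounded_operator X Y G ->
  bounded_operator X Y (fun x => F x + G x).
Proof.
move=> cX cY bF bG; split.
- by move=> x Xx; exact (csmD cY (bop_mem bF Xx) (bop_mem bG Xx)).
- by move=> x y Xx Xy; rewrite (bopD bF)// (bopD bG)//; abelian.
- by move=> a x Xx; rewrite (bop_act bF)// (bop_act bG)// hactDr.
- have [C [_ HC]] := bop_bound bF; have [D [_ HD]] := bop_bound bG.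
  exists (C + D) => x Xx; rewrite mulrDl.
  have hF := csm_HA cY (bop_mem bF Xx); have hG := csm_HA cY (bop_mem bG Xx).
  apply: (le_trans (hnorm_add hF hG)).
  by apply: lerD; [exact: HC|exact: HD].
Qed.

(** The continuity method.  The operators S + t, t >= 0, are all bounded below
    by d^2, because <(S + t) x, x> >= <W x, W x>.  For t large S + t is a
    perturbation of t; and if S + t + h is onto, so is its perturbation S + t,
    with a step h = d^2 / 2 that does not depend on t.  Thus one descends to
    t = 0. *)
Lemma positive_surjective Y S W d : closed_submodule Y ->
  bounded_operator Y Y S -> 0 < d ->
  (forall x, Y x -> [/\ HA (W x), hip (S x) x = hip (W x) (W x)
     & d * hnorm x <= hnorm (W x)]) ->
  forall y, Y y -> exists x, Y x /\ S x = y.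
Proof.
move=> cY bS d0 HW.
pose L t x := S x + rsc t x.
have bL t : bounded_operator Y Y (L t).
  by apply: bounded_operatorD => //; exact: rsc_bounded.
have hY x : Y x -> HA x by exact: csm_HA.
have Lbelow t x : 0 <= t -> Y x -> hnorm x <= (d ^+ 2)^-1 * hnorm (L t x).
  move=> t0 Yx; have [hW SW dW] := HW x Yx.
  rewrite ler_pdivlMl ?exprn_gt0//.
  have hSx := hY _ (bop_mem bS Yx); have hx := hY _ Yx.
  have [x0|x0] := leP (hnorm x) 0.
    have -> : hnorm x = 0 by apply/le_anti; rewrite x0 hnorm_ge0.
    by rewrite mulr0 hnorm_ge0.
  have hL := hY _ (bop_mem (bL t) Yx).
  rewrite -(ler_pM2r x0); apply: le_trans (hip_cauchy_schwarz hL hx).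
  rewrite /L hipDl//; last exact: HAact.
  rewrite SW hip_actl// emb_mul.
  apply: (@le_trans _ _ (nrm (hip (W x) (W x)))); last first.
    apply: pos_mono; first exact: pos_hip.
    have -> : hip (W x) (W x) + t%:C *: hip x x - hip (W x) (W x) =
      t%:C *: hip x x by abelian.
    by apply: posZ => //; exact: pos_hip.
  rewrite -hnorm_sqr -mulrA -expr2 -exprMn.
  by rewrite ler_sqr ?nnegrE ?mulr_ge0 ?hnorm_ge0 ?(ltW d0).
have [D [D0 HD]] := bop_bound bS.
pose h := d ^+ 2 / 2; have h0 : 0 < h by rewrite divr_gt0// exprn_gt0.
pose onto t := forall y, Y y -> exists x, Y x /\ L t x = y.
(* The step h is half of the lower bound d^2, which makes the Neumann series
   converge with ratio 1/2. *)
have down t : 0 <= t -> onto (t + h) -> onto t.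
  move=> t0 ont y Yy.
  have dhE : (d ^+ 2)^-1 * h = 2^-1.
    by rewrite /h mulrA mulVf ?mul1r// expf_neq0// gt_eqF.
  have dhle : (d ^+ 2)^-1 * h <= 2^-1 by rewrite dhE.
  have d20 : 0 <= (d ^+ 2)^-1 by rewrite invr_ge0 sqr_ge0.
  have th : 0 <= t + h by lra.
  have [||z [Yz Lz]] := surjective_perturbation cY (bL (t + h))
    (rsc_bounded (- h) cY) d20 dhle _ _ Yy.
  - move=> w /ont[x [Yx <-]]; exists x; split=> //; exact: Lbelow.
  - by move=> x /hY hx; rewrite (le_trans (hnorm_rsc _ hx))// normrN gtr0_norm.
  exists z; split=> //; rewrite -Lz /L /rsc embD hactDl.
  have -> : emb (- h) = - emb h :> A by rewrite /emb rmorphN scaleNr.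
  by rewrite hactNl; abelian.
have start t : 0 < t -> 2 * D <= t -> onto t.
  move=> t0 Dt y Yy.
  have tV0 : 0 <= t^-1 by rewrite invr_ge0 ltW.
  have tD : t^-1 * D <= 2^-1.
    by rewrite ler_pdivrMl//; move: Dt; lra.
  have [||z [Yz Lz]] :=
    surjective_perturbation cY (rsc_bounded t cY) bS tV0 tD _ _ Yy.
  - move=> w Yw; exists (rsc t^-1 w); split; first exact: csm_act.
      by rewrite rscK// gt_eqF.
    by rewrite (le_trans (hnorm_rsc _ (hY _ Yw)))// ger0_norm.
  - by move=> x /HD.
  by exists z; split=> //; rewrite -Lz /L addrC.
have all_onto n : onto (n%:R * h) -> onto 0.
  elim: n => [|n IH]; first by rewrite mul0r.
  rewrite -natr1 mulrDl mul1r => H; apply: IH; apply: down => //.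
  by rewrite mulr_ge0// ltW.
have on0 : onto 0.
  pose n := (Num.bound (2 * D / h)).
  apply: (all_onto n); apply: start; last first.
    rewrite -ler_pdivrMr// ltW//; apply: archi_boundP.
    by rewrite divr_ge0 ?(ltW h0)// mulr_ge0// ltW.
  rewrite mulr_gt0//; apply: le_lt_trans (archi_boundP _);
  by rewrite divr_ge0 ?(ltW h0)// mulr_ge0// ltW.
move=> y /on0[x [Yx Lx]]; exists x; split=> //.
by rewrite -Lx /L /rsc /emb scale0r hact0l addr0.
Qed.

End Submodules.

(** * The open mapping theorem *)

Section OpenMapping.
Context {R : realType} {A : cstarAlgType R}.
Implicit Types (a : A) (t e C D : R) (x y z : nat -> A).
Implicit Types (M K X Y : set (nat -> A)) (u v : nat -> nat -> A).

Let cHA : closed_submodule (@HA R A) := closed_submodule_HA.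

Lemma range_closed Y T C : closed_submodule Y -> bounded_operator Y HA T ->
  (forall x, Y x -> hnorm x <= C * hnorm (T x)) ->
  closed_submodule [set T x | x in Y].
Proof.
move=> cY bT TC; have hY x : Y x -> HA x by exact: csm_HA.
split.
- by move=> _ [x Yx <-]; exact (bop_mem bT Yx).
- by exists 0; [exact: csm0|exact: bop0 cY bT].
- move=> _ _ [x Yx <-] [y Yy <-]; exists (x + y); first exact: csmD.
  by rewrite (bopD bT).
- move=> a _ [x Yx <-]; exists (hact a x); first exact: csm_act.
  by rewrite (bop_act bT).
- move=> y [hy yT].
  have /choice[u Hu] : forall n, exists x,
      Y x /\ hnorm (y - T x) < 2^-1 ^+ n.
    move=> n; have [|_ [[x Yx <-] yx]] := yT (2^-1 ^+ n).
      by rewrite exprn_gt0// invr_gt0.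
    by exists x.
  have Yu n : Y (u n) by case: (Hu n).
  have hTu n : HA (T (u n)) by exact (bop_mem bT (Yu n)).
  have uC n : hnorm (T (u n) - y) < 2^-1 ^+ n.
    by rewrite hnorm_distC//; case: (Hu n).
  have Tuy : hcvg (fun n => T (u n)) y.
    apply/hcvgP => e e0; have [N HN] := geometric_small 1 e0.
    exists N => // n /= /HN; rewrite mul1r; exact: lt_trans.
  have [x [hx ux]] : exists x, HA x /\ hcvg u x.
    apply: HA_complete; first by move=> n; exact: hY.
    move=> e e0; have [N HN] := geometric_small (2 * C) e0.
    exists N => m n /andP[Nm mn].
    have Cp : 0 <= C \/ hnorm (u n - u m) = 0.
      have [C0|C0] := leP 0 C; [by left|right].
      apply/le_anti; rewrite hnorm_ge0 andbT.
      apply: (le_trans (TC _ (csmB cY (Yu n) (Yu m)))).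
      by rewrite mulr_le0_ge0 ?hnorm_ge0// ltW.
    case: Cp => [C0|->//].
    apply: (le_lt_trans (TC _ (csmB cY (Yu n) (Yu m)))).
    apply: le_lt_trans (HN _ Nm); rewrite -mulrA mulrCA ler_wpM2l//.
    rewrite (bopB cY bT)//.
    have -> : T (u n) - T (u m) = (T (u n) - y) - (T (u m) - y) by abelian.
    apply: (le_trans (hnorm_sub (HAB (hTu n) hy) (HAB (hTu m) hy))).
    have h1 := uC n; have h2 := uC m.
    have : 2^-1 ^+ n <= 2^-1 ^+ m :> R.
      by rewrite ler_wiXn2l ?invr_ge0// invf_le1// ler1n.
    lra.
  have Yx : Y x by exact (csm_lim cY Yu hx ux).
  exists x => //; apply: (hcvg_unique hTu _ hy) Tuy.
    exact (bop_mem bT Yx).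
  exact: (bop_hcvg cY bT).
Qed.

Lemma hilbert_iso_of_below X Y F C : closed_submodule X -> closed_submodule Y ->
  bounded_operator X Y F ->
  (forall x, X x -> hnorm x <= C * hnorm (F x)) ->
  (forall y, Y y -> exists x, X x /\ F x = y) -> hilbert_iso X Y F.
Proof.
move=> cX cY bF FC Fsurj; split=> //.
have Finj x x' : X x -> X x' -> F x = F x' -> x = x'.
  move=> Xx Xx' FF; have Xd := csmB cX Xx Xx'.
  apply/eqP; rewrite -subr_eq0; apply/eqP/hnorm0_eq0.
    exact (csm_HA cX Xd).
  by rewrite (le_trans (FC _ Xd))// (bopB cX bF)// FF subrr hnorm0 mulr0.
have /choice[G HG] : forall y, exists x, Y y -> X x /\ F x = y.
  move=> y; have [Yy|nYy] := pselect (Y y); last by exists 0.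
  by have [x Hx] := Fsurj y Yy; exists x.
have XG y : Y y -> X (G y) by move=> /HG[].
have FG y : Y y -> F (G y) = y by move=> /HG[].
exists G; split=> //; last first.
  move=> x Xx; have YFx := bop_mem bF Xx.
  by apply: Finj => //; [exact: XG|rewrite FG].
split=> //.
- move=> x y Yx Yy; have Yxy := csmD cY Yx Yy.
  apply: Finj; [exact: XG|by apply: csmD => //; exact: XG|].
  by rewrite (bopD bF) ?FG//; exact: XG.
- move=> a y Yy; have Yay := csm_act cY a Yy.
  apply: Finj; [exact: XG|by apply: csm_act => //; exact: XG|].
  by rewrite (bop_act bF) ?FG//; exact: XG.
- by exists C => y Yy; have := FC _ (XG y Yy); rewrite FG.
Qed.

(** Baire's theorem.  If the conclusion fails, there are nested balls such that
    the n-th one avoids [P n]; their common point contradicts the covering. *)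
Lemma baire_HA (P : nat -> set (nat -> A)) :
  (forall y, HA y -> exists n, P n y) ->
  exists n x r, [/\ HA x, 0 < r & forall y, HA y -> hnorm (y - x) <= r ->
    forall e, 0 < e -> exists z, P n z /\ hnorm (y - z) < e].
Proof.
move=> Pcover; apply: contrapT => noball.
have step (p : nat * ((nat -> A) * R)) : exists q : (nat -> A) * R,
    HA p.2.1 -> 0 < p.2.2 ->
    [/\ HA q.1, hnorm (q.1 - p.2.1) <= p.2.2 / 2, 0 < q.2, q.2 <= p.2.2 / 2
      & forall z, P p.1 z -> q.2 < hnorm (q.1 - z)].
  case: p => n [x r] /=; have [hx|] := pselect (HA x); last by exists (0, 0).
  have [r0|_] := ltP 0 r; last by exists (0, 0).
  have r20 : 0 < r / 2 by lra.
  have [[y e] /= [hy yx e0 He]] : exists q : (nat -> A) * R,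
    [/\ HA q.1, hnorm (q.1 - x) <= r / 2, 0 < q.2
      & forall z, P n z -> q.2 <= hnorm (q.1 - z)].
    apply: contrapT => H; apply: noball; exists n, x, (r / 2).
    split=> // y hy yx e e0; apply: contrapT => H'.
    apply: H; exists (y, e); split=> //= z Pz; rewrite leNgt; apply/negP => ze.
    by apply: H'; exists z.
  exists (y, Num.min (r / 2) (e / 2)) => _ _ /=; split=> //.
  - by rewrite lt_min r20/=; lra.
  - by rewrite ge_min lexx.
  - move=> z /He h; apply: lt_le_trans h.
    by rewrite gt_min; apply/orP; right; lra.
have [f Hf] := choice step.
pose st := fix st n :=
  if n is n'.+1 then f (n', st n') else (0 : nat -> A, 1 : R).
pose x n := (st n).1; pose r n := (st n).2.
have st_ok n : HA (x n) /\ 0 < r n.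
  elim: n => [|n [hx r0]]; first by split; [exact: HA0|exact: ltr01].
  by have [] := Hf (n, st n) hx r0.
have hx n : HA (x n) by case: (st_ok n).
have r0 n : 0 < r n by case: (st_ok n).
have stS n : [/\ HA (x n.+1), hnorm (x n.+1 - x n) <= r n / 2, 0 < r n.+1,
    r n.+1 <= r n / 2 & forall z, P n z -> r n.+1 < hnorm (x n.+1 - z)].
  exact: Hf (n, st n) (hx n) (r0 n).
have rle n : r n <= 2^-1 ^+ n.
  elim: n => [|n IH]; first by rewrite expr0.
  by have [_ _ _ h _] := stS n; rewrite exprS; lra.
have xdist n k : hnorm (x (n + k)%N - x n) <= r n - r (n + k)%N.
  elim: k => [|k IH]; first by rewrite addn0 !subrr hnorm0.
  have [_ h1 _ h2 _] := stS (n + k)%N.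
  have -> : x (n + k.+1)%N - x n =
      (x (n + k).+1 - x (n + k)%N) + (x (n + k)%N - x n).
    by rewrite addnS; abelian.
  apply: (le_trans (hnorm_add (HAB (hx _) (hx _)) (HAB (hx _) (hx _)))).
  by rewrite addnS; lra.
have [l [hl xl]] : exists l, HA l /\ hcvg x l.
  apply: HA_complete => // e e0; have [N HN] := geometric_small 1 e0.
  exists N => m n /andP[Nm mn]; have := HN m Nm; rewrite mul1r.
  have := xdist m (n - m)%N; rewrite subnKC//.
  by have := rle m; have := r0 n; lra.
have ldist n : hnorm (x n - l) <= r n.
  apply/ler_addgt0Pr => e e0.
  have /hcvgP/(_ _ e0)[N _ HN] := xl.
  have := HN (n + N)%N (leq_addl _ _); have := xdist n N => h1 h2.
  have -> : x n - l = (x (n + N)%N - l) - (x (n + N)%N - x n) by abelian.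
  apply: (le_trans (hnorm_sub (HAB (hx _) hl) (HAB (hx _) (hx _)))).
  by have := r0 (n + N)%N; move: h2 => /=; lra.
have [n Pn] := Pcover l hl.
have [_ _ _ _ /(_ _ Pn)] := stS n.
by rewrite ltNge ldist.
Qed.

(** Banach's theorem for the map (m, c) |-> m + T c, in the two cases needed:
    T an inclusion, which bounds the projections of a direct sum, and T the
    operator with a given finite family of generators as range. *)
Lemma open_mapping M K T : closed_submodule M -> closed_submodule K ->
  bounded_operator K HA T ->
  (forall y, HA y -> exists m c, [/\ M m, K c & y = m + T c]) ->
  exists C, 0 < C /\ forall y, HA y -> exists m c,
    [/\ M m, K c, y = m + T c, hnorm m <= C * hnorm y
      & hnorm c <= C * hnorm y].
Proof.
move=> cM cK bT cover.
have hM x : M x -> HA x by exact: csm_HA.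
have hK x : K x -> HA x by exact: csm_HA.
pose P n y := exists m c,
  [/\ M m, K c, hnorm m <= n%:R, hnorm c <= n%:R & y = m + T c].
have [y hy|n [x0 [r [hx0 r0 ball]]]] := @baire_HA P.
  have [m [c [Mm Kc ->]]] := cover y hy.
  exists (maxn (Num.bound (hnorm m)) (Num.bound (hnorm c))), m, c.
  by split=> //; apply: ltW; apply: lt_le_trans (archi_boundP (hnorm_ge0 _)) _;
    rewrite ler_nat ?leq_maxl ?leq_maxr.
pose D := 2 * n%:R / r; have D0 : 0 <= D by rewrite divr_ge0 ?mulr_ge0// ltW.
(* Differences of two points of the ball of Baire's theorem, rescaled: every y
   is approximated by images of vectors of norm at most D |y|. *)
have approx y e : HA y -> 0 < e -> exists p : (nat -> A) * (nat -> A),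
  [/\ M p.1, K p.2, hnorm p.1 <= D * hnorm y, hnorm p.2 <= D * hnorm y
    & hnorm (y - (p.1 + T p.2)) < e].
  move=> hy e0; have [y0|y0] := leP (hnorm y) 0.
    have Dy : 0 <= D * hnorm y by rewrite mulr_ge0 ?hnorm_ge0.
    exists (0, 0); rewrite /= (bop0 cK bT) addr0 subr0 hnorm0.
    split=> //; [exact: csm0|exact: csm0|exact: le_lt_trans y0 e0].
  set b := hnorm y in y0 *; pose k := r / b.
  have k0 : 0 < k by rewrite divr_gt0.
  have hky : HA (rsc k y) by exact: HAact.
  have kyr : hnorm (rsc k y) <= r.
    rewrite (le_trans (hnorm_rsc _ hy))// gtr0_norm// /k -/b.
    by rewrite divfK// gt_eqF.
  have e20 : 0 < k * e / 2 by rewrite divr_gt0// mulr_gt0.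
  have [|z1 [[m1 [c1 [Mm1 Kc1 m1n c1n ->]]] h1]] :=
    ball _ (HAD hx0 hky) _ _ e20.
    by have -> : x0 + rsc k y - x0 = rsc k y by abelian.
  have [|z2 [[m2 [c2 [Mm2 Kc2 m2n c2n ->]]] h2]] := ball _ hx0 _ _ e20.
    by rewrite subrr hnorm0 ltW.
  exists (rsc k^-1 (m1 - m2), rsc k^-1 (c1 - c2)) => /=.
  have Mm := csmB cM Mm1 Mm2; have Kc := csmB cK Kc1 Kc2.
  have kV0 : 0 <= k^-1 by rewrite invr_ge0 ltW.
  have kD w : HA w -> hnorm w <= n%:R + n%:R -> hnorm (rsc k^-1 w) <= D * b.
    move=> hw wn; rewrite (le_trans (hnorm_rsc _ hw))// ger0_norm//.
    rewrite (le_trans (ler_wpM2l kV0 wn))// /k invf_div /D.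
    by rewrite mulrAC -mulrA mulrC -mulr2n mulr_natl mulrC.
  split.
  - exact: csm_act.
  - exact: csm_act.
  - apply: kD; first exact: hM.
    by rewrite (le_trans (hnorm_sub (hM _ Mm1) (hM _ Mm2)))// lerD.
  - apply: kD; first exact: hK.
    by rewrite (le_trans (hnorm_sub (hK _ Kc1) (hK _ Kc2)))// lerD.
  - rewrite (bop_act bT)// (bopB cK bT)// -hactDr -[y](rscVK _ (lt0r_neq0 k0)).
    rewrite -hactBr.
    have hT1 := bop_mem bT Kc1; have hT2 := bop_mem bT Kc2.
    have hz1 := HAD (hM _ Mm1) hT1; have hz2 := HAD (hM _ Mm2) hT2.
    have hw1 := HAB (HAD hx0 hky) hz1; have hw2 := HAB hx0 hz2.
    have -> : rsc k y - (m1 - m2 + (T c1 - T c2)) =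
        (x0 + rsc k y - (m1 + T c1)) - (x0 - (m2 + T c2)) by abelian.
    apply: (le_lt_trans (hnorm_rsc _ (HAB hw1 hw2))).
    rewrite ger0_norm// ltr_pdivrMl//.
    by apply: (le_lt_trans (hnorm_sub hw1 hw2)); lra.
(* Successive approximations remove the error. *)
have cvgd y : HA y -> 0 < hnorm y -> exists m c,
    [/\ M m, K c, y = m + T c, hnorm m <= 2 * (D * hnorm y)
      & hnorm c <= 2 * (D * hnorm y)].
  move=> hy b0; set b := hnorm y in b0 *.
  have /choice[f Hf] (p : nat * (nat -> A)) :
      exists q : (nat -> A) * (nat -> A), HA p.2 ->
      [/\ M q.1, K q.2, hnorm q.1 <= D * hnorm p.2,
        hnorm q.2 <= D * hnorm p.2
        & hnorm (p.2 - (q.1 + T q.2)) < b * 2^-1 ^+ p.1.+1].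
    have [hp|] := pselect (HA p.2); last by exists (0, 0).
    have e0 : 0 < b * 2^-1 ^+ p.1.+1 by rewrite mulr_gt0// exprn_gt0// invr_gt0.
    by have [q Hq] := approx p.2 _ hp e0; exists q.
  pose w := fix w n := if n is n'.+1 then
    w n' - ((f (n', w n')).1 + T (f (n', w n')).2) else y.
  have hw n' : HA (w n').
    elim: n' => [//|n' IH] /=; have [Mq Kq _ _ _] := Hf (n', w n') IH.
    exact (HAB IH (HAD (hM _ Mq) (bop_mem bT Kq))).
  pose ms n' := (f (n', w n')).1; pose cs n' := (f (n', w n')).2.
  have Mms n' : M (ms n') by have [] := Hf (n', w n') (hw n').
  have Kcs n' : K (cs n') by have [] := Hf (n', w n') (hw n').
  have wb n' : hnorm (w n') <= b * 2^-1 ^+ n'.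
    elim: n' => [|n' IH]; first by rewrite expr0 mulr1.
    by apply: ltW; have [_ _ _ _] := Hf (n', w n') (hw n').
  have Dw n' t : t <= D * hnorm (w n') -> t <= D * b * 2^-1 ^+ n'.
    by move=> h; rewrite (le_trans h)// -mulrA ler_wpM2l.
  have msb n' : hnorm (ms n') <= D * b * 2^-1 ^+ n'.
    by apply: Dw; have [] := Hf (n', w n') (hw n').
  have csb n' : hnorm (cs n') <= D * b * 2^-1 ^+ n'.
    by apply: Dw; have [] := Hf (n', w n') (hw n').
  have [m [Mm msm mb]] := geometric_series cM Mms msb.
  have [c [Kc csc cb]] := geometric_series cK Kcs csb.
  exists m, c; split=> //.
  have sumE k : \sum_(i < k) ms i + T (\sum_(i < k) cs i) = y - w k.
    elim: k => [|k IH]; first by rewrite !big_ord0 (bop0 cK bT) subrr addr0.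
    rewrite !big_ord_recr/= (bopD bT)//; last exact: csm_sum.
    have -> : \sum_(i < k) ms i + ms k + (T (\sum_(i < k) cs i) + T (cs k)) =
      (\sum_(i < k) ms i + T (\sum_(i < k) cs i)) + (ms k + T (cs k)).
      by abelian.
    by rewrite IH /ms /cs; abelian.
  have Ksum k : K (\sum_(i < k) cs i) by exact: csm_sum.
  have Msum k : M (\sum_(i < k) ms i) by exact: csm_sum.
  have hTc := bop_mem bT Kc.
  apply: (@hcvg_unique _ _ (fun k => y - w k)) => //.
  - by move=> k; exact: HAB.
  - by apply: HAD => //; exact: hM.
  - apply/hcvgP => e e0; have [N HN] := geometric_small b e0.
    exists N => // k /= /HN; apply: le_lt_trans.
    have -> : y - w k - y = - w k by abelian.
    by rewrite hnorm_opp.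
  - apply: hcvg_ext sumE _; apply: hcvgD => //.
    + by move=> k; exact: hM.
    + by move=> k; exact (bop_mem bT (Ksum k)).
    + exact: hM.
    + exact: (bop_hcvg cK bT).
exists (2 * D + 1); split; first lra.
move=> y hy; have [y0|y0] := leP (hnorm y) 0.
  exists 0, 0.
  rewrite (bop0 cK bT) addr0 hnorm0 (hnorm0_eq0 hy y0) hnorm0 mulr0.
  by split=> //; exact: csm0.
have [m [c [Mm Kc ymc mb cb]]] := cvgd y hy y0.
by exists m, c; split=> //; nra.
Qed.

End OpenMapping.

(** * Coordinates, truncation and translation *)

Section Coordinates.
Context {R : realType} {A : cstarAlgType R}.
Implicit Types (a : A) (t e C D : R) (x y z c : nat -> A) (f : nat -> nat -> A).

Let cHA : closed_submodule (@HA R A) := closed_submodule_HA.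

Lemma hip_finite k x y : (forall i, (k <= i)%N -> x i = 0) ->
  hip x y = sip 0 k x y.
Proof.
move=> x0; apply: hip_cvgE; apply/cvgA => e e0; exists k => // n /= kn.
rewrite -[series _ n]/(sip 0 n x y) (@sip_cat _ _ 0 k n)//.
have -> : sip k n x y = 0.
  rewrite /sip big_nat_cond big1// => i /andP[/andP[ki _] _].
  by rewrite x0// cmul0l.
by rewrite addr0 subrr nrm0.
Qed.

Lemma HA_finite k x : (forall i, (k <= i)%N -> x i = 0) -> HA x.
Proof.
move=> x0; apply/HA_seg => e e0; exists k => i j /andP[ki ij].
have -> : seg i j x = 0; last by [].
rewrite /seg /sip big_nat_cond big1 ?nrm0 ?sqrtr0// => l /andP[/andP[il _] _].
by rewrite x0 ?cmul0l// (leq_trans ki).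
Qed.

Lemma HA_basis n : HA (hbasis n : nat -> A).
Proof. by apply: (@HA_finite n.+1) => i ni; rewrite /hbasis gtn_eqF. Qed.

Arguments HA_basis : clear implicits.

Lemma hip_basis n y : hip (hbasis n) y = star (y n).
Proof.
rewrite (@hip_finite n.+1); last by move=> i ni; rewrite /hbasis gtn_eqF.
rewrite /sip big_nat_recr//= big_nat_cond big1 ?add0r.
  by rewrite /hbasis eqxx cmul1l.
by move=> i /andP[/andP[_ ni] _]; rewrite /hbasis ltn_eqF// cmul0l.
Qed.

Lemma hnorm_basis n : hnorm (hbasis n : nat -> A) <= 1.
Proof.
rewrite -ler_sqr ?nnegrE ?hnorm_ge0// hnorm_sqr hip_basis.
by rewrite /hbasis eqxx star1 expr1n nrm1.
Qed.

Definition truncate k c : nat -> A := \sum_(i < k) hact (c i) (hbasis i).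

Lemma truncateE k c i : truncate k c i = if (i < k)%N then c i else 0.
Proof.
rewrite /truncate fct_sumE; have [ik|ki] := ltnP i k.
  rewrite (bigD1 (Ordinal ik))//= /hact /hbasis eqxx cmul1r big1 ?addr0//.
  move=> j /eqP ji; rewrite ifN ?cmul0r//; apply/eqP => ij.
  by apply: ji; apply: val_inj.
rewrite big1// => j _; rewrite /hact /hbasis gtn_eqF ?cmul0r//.
exact: leq_trans ki.
Qed.

Lemma HA_truncate k c : HA (truncate k c).
Proof. by apply: HA_sum => i; apply: HAact; exact: HA_basis. Qed.

Arguments HA_truncate : clear implicits.

Lemma truncate_cvg c : HA c -> hcvg (fun k => truncate k c) c.
Proof.
move=> hc; apply/hcvgP => e e0; have e20 : 0 < e / 2 by lra.
have /HA_seg/(_ _ e20)[N HN] := hc.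
exists N => // k /= Nk; apply: (@le_lt_trans _ _ (e / 2)); last by lra.
apply: hnorm_le_seg; [by lra|exact (HAB (HA_truncate k c) hc)|move=> l].
have seg0 : seg 0 k (truncate k c - c) = 0.
  rewrite /seg /sip big_nat_cond big1 ?nrm0 ?sqrtr0// => i /andP[/andP[_ ik] _].
  rewrite -[(truncate k c - c) i]/(truncate k c i - c i) truncateE ik.
  by rewrite subrr cmul0l.
have [lk|kl] := leqP l k.
  rewrite (le_trans (@seg_sub _ _ 0 l 0 k _ _ lk))// seg0; lra.
have -> : seg 0 l (truncate k c - c) = seg k l c.
  rewrite -[RHS]segN /seg (@sip_cat _ _ 0 k l) ?(ltnW kl)//.
  have -> : sip 0 k (truncate k c - c) (truncate k c - c) = 0.
    by apply: nrm0_eq0; rewrite -seg_sqr seg0 expr0n.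
  rewrite add0r; congr (Num.sqrt (nrm _)); apply: eq_big_nat => i /andP[ki _].
  have -> : (truncate k c - c) i = (- c) i; last by [].
  by rewrite -[LHS]/(truncate k c i - c i) truncateE ltnNge ki/= sub0r.
by apply/ltW/HN; rewrite Nk ltnW.
Qed.

Lemma bop_truncate Y F k c : bounded_operator HA Y F ->
  F (truncate k c) = \sum_(i < k) hact (c i) (F (hbasis i)).
Proof.
move=> bF; rewrite /truncate (bop_sum cHA bF); last first.
  by move=> i; apply: HAact; exact: HA_basis.
by apply: eq_bigr => i _; rewrite (bop_act bF)//; exact: HA_basis.
Qed.

Lemma bop_expand F c : bounded_operator HA HA F -> HA c ->
  hcvg (fun k => \sum_(i < k) hact (c i) (F (hbasis i))) (F c).
Proof.
move=> bF hc; apply: (@hcvg_ext _ _ (fun k => F (truncate k c))).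
  by move=> k; exact: bop_truncate bF.
exact (bop_hcvg cHA bF (fun k => HA_truncate k c) hc (truncate_cvg hc)).
Qed.

Lemma hnorm_truncate k x : hnorm (truncate k x) <= \sum_(i < k) nrm (x i).
Proof.
have hb i : HA (hact (x i) (hbasis i)) by apply: HAact; exact: HA_basis.
rewrite /truncate; elim: k => [|k IH]; first by rewrite !big_ord0 hnorm0.
rewrite !big_ord_recr/=; apply: (le_trans (hnorm_add (HA_truncate k x) (hb k))).
apply: lerD => //; apply: (le_trans (hnorm_act _ (HA_basis k))).
by rewrite -[leRHS]mulr1 ler_wpM2l ?nrm_ge0// hnorm_basis.
Qed.

Lemma truncate_finite k x : (forall i, (k <= i)%N -> x i = 0) ->
  truncate k x = x.
Proof.
by move=> x0; apply/funext => i; rewrite truncateE; case: ltnP => // /x0.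
Qed.

Definition pad m c : nat -> A := fun i => if (i < m)%N then 0 else c (i - m)%N.
Definition skip m c : nat -> A := fun i => c (m + i)%N.

Lemma pad_series m (g : nat -> A) n :
  series (fun i => if (i < m)%N then 0 else g (i - m)%N) (n + m)%N = series g n.
Proof.
rewrite /series /= (@big_cat_nat _ _ _ m)//=; last exact: leq_addl.
rewrite big_nat_cond big1 ?add0r; last by move=> i /andP[/andP[_ ->]].
rewrite -{1}[m]add0n big_addn addnK; apply: eq_bigr => i _.
by rewrite ltnNge leq_addl/= addnK.
Qed.

Lemma pad_mul m c y i : pad m c i ** star (y i) =
  if (i < m)%N then 0 else c (i - m)%N ** star (skip m y (i - m)%N).
Proof.
by rewrite /pad /skip; case: ltnP => [_|mi]; rewrite ?cmul0l// subnKC.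
Qed.

Lemma seg_skip m k l c : seg k l (skip m c) = seg (m + k) (m + l) c.
Proof.
congr (Num.sqrt (nrm _)); rewrite /sip /skip.
rewrite (addnC m k) (addnC m l) big_addn addnK.
by apply: eq_bigr => i _; rewrite addnC.
Qed.

Lemma HA_skip m c : HA c -> HA (skip m c).
Proof.
move=> /HA_seg H; apply/HA_seg => e /H[N HN]; exists N => k l /andP[Nk kl].
by rewrite seg_skip HN// leq_add2l kl andbT (leq_trans Nk)// leq_addl.
Qed.

Arguments HA_skip m [c] _.

Lemma HA_pad m c : HA c -> HA (pad m c).
Proof.
move=> hc; apply: (cvgP (hip c c)).
rewrite -(cvg_shiftn m); have := hip_cvg hc hc.
rewrite (_ : [sequence _]_n = series (fun i => c i ** star (c i)))//.
apply/funext => n; rewrite -(pad_series m); congr (series _ _).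
apply/funext => i; rewrite pad_mul /skip /pad.
by case: ltnP => // mi; rewrite subnKC// ltnNge mi.
Qed.

Arguments HA_pad m [c] _.

Lemma hip_pad m c y : HA c -> HA y ->
  hip (pad m c) y = hip c (skip m y).
Proof.
move=> hc hy; apply: hip_cvgE; rewrite -(cvg_shiftn m).
have := hip_cvg hc (HA_skip m hy).
rewrite (_ : [sequence _]_n = series (fun i => c i ** star (skip m y i)))//.
apply/funext => n; rewrite -(pad_series m); congr (series _ _).
by apply/funext => i; rewrite pad_mul.
Qed.

Lemma padK m c : skip m (pad m c) = c.
Proof.
apply/funext => i; rewrite /skip /pad ltnNge leq_addr/=.
by rewrite addnC addnK.
Qed.

Lemma hnorm_pad m c : HA c -> hnorm (pad m c) = hnorm c.
Proof.
by move=> hc; rewrite /hnorm hip_pad ?padK//; exact: HA_pad.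
Qed.

Lemma pad_basis m n : pad m (hbasis n) = hbasis (m + n) :> (nat -> A).
Proof.
apply/funext => i; rewrite /pad /hbasis; case: ltnP => [im|mi].
  by rewrite ltn_eqF// (leq_trans im) ?leq_addr.
by rewrite -(eqn_add2l m) subnKC.
Qed.

Lemma pad_bounded m : bounded_operator HA HA (pad m).
Proof.
split.
- exact: HA_pad.
- move=> x y _ _; apply/funext => i; rewrite /pad /=.
  by rewrite -[RHS]/((if (i < m)%N then 0 else x (i - m)%N) +
    (if (i < m)%N then 0 else y (i - m)%N)); case: ifP; rewrite ?addr0.
- move=> a x _; apply/funext => i; rewrite /pad /hact.
  by case: ifP; rewrite ?cmul0r.
- by exists 1 => x hx; rewrite mul1r hnorm_pad.
Qed.

Lemma truncate_pad m c : c = truncate m c + pad m (skip m c).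
Proof.
apply/funext => i; rewrite -[RHS]/(truncate m c i + pad m (skip m c) i).
rewrite truncateE /pad /skip; case: ltnP => [_|mi]; rewrite ?addr0//.
by rewrite add0r subnKC.
Qed.

Lemma skip_small c e : HA c -> 0 < e ->
  exists N, forall m, (N <= m)%N -> hnorm (skip m c) <= e.
Proof.
move=> hc e0; have /HA_seg/(_ _ e0)[N HN] := hc; exists N => m Nm.
apply: hnorm_le_seg; [exact: ltW|exact: HA_skip|move=> l].
by rewrite seg_skip addn0 ltW// HN// Nm leq_addr.
Qed.

End Coordinates.
Arguments HA_basis {R A} n.
Arguments HA_truncate {R A} k c.
Arguments HA_skip {R A} m [c] _.
Arguments HA_pad {R A} m [c] _.

(** * Adjointable operators *)

Section Adjoints.
Context {R : realType} {A : cstarAlgType R}.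
Implicit Types (a : A) (t e C D : R) (x y z c : nat -> A) (f : nat -> nat -> A).
Implicit Types (F G : (nat -> A) -> nat -> A).

Let cHA : closed_submodule (@HA R A) := closed_submodule_HA.

Lemma hip_ext x y : HA x -> HA y -> (forall z, HA z -> hip x z = hip y z) ->
  x = y.
Proof.
move=> hx hy xy; have hd := HAB hx hy.
apply/eqP; rewrite -subr_eq0; apply/eqP/hip0_eq0 => //.
by rewrite hipBl// xy// subrr.
Qed.

(** Linearity is automatic, since <F c, y> = <c, G y> for all y determines
    F c; and |F c|^2 = <c, G (F c)> gives the bound. *)
Lemma adjoint_bounded F G C :
  (forall c, HA c -> HA (F c)) -> (forall y, HA y -> HA (G y)) ->
  (forall c y, HA c -> HA y -> hip (F c) y = hip c (G y)) ->
  (forall y, HA y -> hnorm (G y) <= C * hnorm y) -> bounded_operator HA HA F.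
Proof.
move=> hF hG FG GC; split=> //.
- move=> x y hx hy; have hxy := HAD hx hy.
  have hFx := hF _ hx; have hFy := hF _ hy.
  apply: hip_ext => [||z hz]; [exact: hF|exact: HAD|].
  have hGz := hG _ hz.
  by rewrite hipDl// !FG// hipDl.
- move=> a x hx; have hax := HAact a hx; have hFx := hF _ hx.
  apply: hip_ext => [||z hz]; [exact: hF|exact: HAact|].
  have hGz := hG _ hz.
  by rewrite hip_actl// !FG// hip_actl.
- exists C => x hx; have hFx := hF _ hx; have hGF := hG _ hFx.
  have [x0|x0] := leP (hnorm (F x)) 0.
    have F0 : hnorm (F x) = 0 by apply/le_anti; rewrite x0 hnorm_ge0.
    have [C0|C0] := leP 0 C; first by rewrite F0 mulr_ge0// hnorm_ge0.
    have x0' : hnorm x = 0.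
      apply/le_anti; rewrite hnorm_ge0 andbT leNgt; apply/negP => x1.
      have := GC x hx; have := hnorm_ge0 (G x).
      by nra.
    by rewrite F0 x0' mulr0.
  rewrite -(ler_pM2r x0) -expr2 hnorm_sqr FG//.
  apply: (le_trans (hip_cauchy_schwarz hx hGF)).
  have := GC _ hFx; have := hnorm_ge0 x; nra.
Qed.

Lemma bounded_operator_comp (X Y Z : set (nat -> A)) F G :
  bounded_operator X Y F -> bounded_operator Y Z G ->
  bounded_operator X Z (fun x => G (F x)).
Proof.
move=> bF bG; split.
- by move=> x Xx; exact (bop_mem bG (bop_mem bF Xx)).
- move=> x y Xx Xy; have YFx := bop_mem bF Xx; have YFy := bop_mem bF Xy.
  by rewrite (bopD bF)// (bopD bG).
- move=> a x Xx; have YFx := bop_mem bF Xx.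
  by rewrite (bop_act bF)// (bop_act bG).
- have [C [C0 HC]] := bop_bound bF; have [D [D0 HD]] := bop_bound bG.
  exists (D * C) => x Xx; rewrite (le_trans (HD _ (bop_mem bF Xx)))//.
  by rewrite -mulrA ler_wpM2l ?HC// ltW.
Qed.

Lemma kernel_closed F : bounded_operator HA HA F ->
  closed_submodule [set x | HA x /\ F x = 0].
Proof.
move=> bF; split.
- by move=> x [].
- by split; [exact: HA0|exact: bop0 cHA bF].
- move=> x y [hx Fx] [hy Fy]; split; first exact: HAD.
  by rewrite (bopD bF)// Fx Fy addr0.
- move=> a x [hx Fx]; split; first exact: HAact.
  by rewrite (bop_act bF)// Fx hact0r.
- move=> x [hx xF]; split=> //; apply: hnorm0_eq0; first exact (bop_mem bF hx).
  apply/ler_addgt0Pr => e e0; rewrite add0r.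
  have [C [C0 HC]] := bop_bound bF.
  have eC0 : 0 < e / C by rewrite divr_gt0.
  have [y [[hy Fy] yx]] := xF _ eC0.
  have -> : F x = F (x - y) by rewrite (bopB cHA bF)// Fy subr0.
  rewrite (le_trans (HC _ (HAB hx hy)))// mulrC -ler_pdivlMr//; exact: ltW.
Qed.

End Adjoints.

(** * The synthesis operator of a Bessel sequence *)

Section Synthesis.
Context {R : realType} {A : cstarAlgType R}.
Implicit Types (a : A) (t e C D : R) (x y z c : nat -> A).
Variable f : nat -> nat -> A.
Hypothesis bf : bessel f.

Let cHA : closed_submodule (@HA R A) := closed_submodule_HA.

Definition analysis y : nat -> A := fun n => hip y (f n).

Let hf n : HA (f n). Proof. by case: bf. Qed.

Lemma analysis_series y : HA y ->
  series (fun n => hip y (f n) ** hip (f n) y) =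
  series (fun n => analysis y n ** star (analysis y n)).
Proof.
move=> hy; congr series; apply/funext => n.
by rewrite /analysis star_hip.
Qed.

Lemma HA_analysis y : HA y -> HA (analysis y).
Proof.
move=> hy; have [_ [M [_ /(_ y hy)[]]]] := bf.
by rewrite analysis_series.
Qed.

Lemma analysis_bound : exists C, 0 < C /\
  forall y, HA y -> hnorm (analysis y) <= C * hnorm y.
Proof.
have [_ [M [M0 HM]]] := bf; exists (Num.sqrt M).
split; first by rewrite sqrtr_gt0.
move=> y hy; have [_] := HM y hy.
rewrite analysis_series// -/(hip (analysis y) (analysis y)).
move=> /pos_cstar_le/(pos_mono (pos_hip (HA_analysis hy))).
rewrite nrmZ_ge0; last exact: ltW.
move=> h.
rewrite -ler_sqr ?nnegrE ?mulr_ge0 ?hnorm_ge0 ?sqrtr_ge0//.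
by rewrite exprMn !hnorm_sqr sqr_sqrtr ?(ltW M0).
Qed.

(** A partial sum p satisfies <p, p> = <c, analysis p> on the segment of the
    summation, so |p| is at most a constant times the norm of c there. *)
Lemma synthesis_cvg c : HA c -> HA (synthesis f c) /\
  hcvg (fun k => \sum_(n < k) hact (c n) (f n)) (synthesis f c).
Proof.
move=> hc; rewrite /synthesis; set P := [set x | _ /\ _].
suff [x Px] : exists x, P x by exact: (xgetPex 0 (ex_intro _ x Px)).
have [C [C0 HC]] := analysis_bound.
have hcf n : HA (hact (c n) (f n)) by exact: HAact.
apply: HA_complete; first by move=> k; exact: HA_sum.
move=> e e0; have eC0 : 0 < e / C by rewrite divr_gt0.
have /HA_seg/(_ _ eC0)[N HN] := hc.
exists N => k l /andP[Nk kl].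
rewrite -!(big_mkord xpredT (fun n => hact (c n) (f n))).
rewrite (@big_cat_nat _ _ _ k 0 l)//= addrAC subrr add0r.
set p := \sum_(k <= i < l) _; have hp : HA p by exact: HA_sum.
have pp : hip p p = sip k l c (analysis p).
  rewrite /p hip_suml//; apply: eq_bigr => i _.
  by rewrite hip_actl// /analysis star_hip.
have pC : hnorm p <= C * seg k l c.
  have [p0|p0] := leP (hnorm p) 0.
    by rewrite (le_trans p0)// mulr_ge0 ?seg_ge0// ltW.
  rewrite -(ler_pM2r p0) -expr2 hnorm_sqr pp.
  apply: (le_trans (sip_cauchy_schwarz _ _ _ _)).
  rewrite -mulrA (mulrCA C) ler_wpM2l ?seg_ge0//.
  by rewrite (le_trans (seg_le_hnorm _ _ (HA_analysis hp)))// HC.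
apply: (le_lt_trans pC); rewrite mulrC -ltr_pdivlMr//.
by apply: HN; rewrite Nk.
Qed.

Lemma HA_synthesis c : HA c -> HA (synthesis f c).
Proof. by move=> /synthesis_cvg[]. Qed.

Lemma synthesis_adjoint c y : HA c -> HA y ->
  hip (synthesis f c) y = hip c (analysis y).
Proof.
move=> hc hy; have [hF Fc] := synthesis_cvg hc.
have hcf n : HA (hact (c n) (f n)) by exact: HAact.
apply/esym/hip_cvgE.
have hs k : HA (\sum_(n < k) hact (c n) (f n)) by exact: HA_sum.
have := hcvg_hip hs hF hy Fc.
rewrite (_ : (fun n => _) = series (fun i => c i ** star (analysis y i)))//.
apply/funext => k; rewrite /series /= big_mkord hip_suml//.
by apply: eq_bigr => i _; rewrite hip_actl// /analysis star_hip.
Qed.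

Lemma synthesis_bounded : bounded_operator HA HA (synthesis f).
Proof.
have [C [C0 HC]] := analysis_bound.
apply: (adjoint_bounded HA_synthesis HA_analysis) HC.
exact: synthesis_adjoint.
Qed.

Lemma synthesis_basis n : synthesis f (hbasis n) = f n.
Proof.
have hn := @HA_basis R A n.
apply: hip_ext => //; first exact: HA_synthesis.
by move=> z hz; rewrite synthesis_adjoint// hip_basis /analysis star_hip.
Qed.

End Synthesis.

(** * Tails bounded below *)

Section TailSynthesis.
Context {R : realType} {A : cstarAlgType R}.
Implicit Types (t e C D : R) (x y z c : nat -> A).
Variable f : nat -> nat -> A.
Hypothesis bf : bessel f.

Let cHA : closed_submodule (@HA R A) := closed_submodule_HA.

Definition tail_synthesis m c := synthesis f (pad m c).
Definition tail_analysis m y := skip m (analysis f y).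

(** The property to which both sides of the equivalence reduce. *)
Definition tail_bounded_below m : Prop :=
  exists C, forall c, HA c -> hnorm c <= C * hnorm (tail_synthesis m c).

Lemma tail_synthesis_bounded m : bounded_operator HA HA (tail_synthesis m).
Proof.
exact (bounded_operator_comp (pad_bounded m) (synthesis_bounded bf)).
Qed.

Lemma HA_tail_analysis m y : HA y -> HA (tail_analysis m y).
Proof. by move=> hy; exact (HA_skip m (HA_analysis bf hy)). Qed.

Arguments HA_tail_analysis m [y] _.

Lemma tail_adjoint m c y : HA c -> HA y ->
  hip (tail_synthesis m c) y = hip c (tail_analysis m y).
Proof.
move=> hc hy; have hs := HA_pad m hc; have ha := HA_analysis bf hy.
by rewrite synthesis_adjoint// hip_pad.
Qed.

Lemma tail_analysis_bounded m : bounded_operator HA HA (tail_analysis m).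
Proof.
have [C [C0 HC]] := bop_bound (tail_synthesis_bounded m).
apply: (@adjoint_bounded _ _ _ (tail_synthesis m) C) => //.
- exact: HA_tail_analysis.
- by move=> c hc; exact (bop_mem (tail_synthesis_bounded m) hc).
- move=> y c hy hc; have hW := HA_tail_analysis m hy.
  have hT := bop_mem (tail_synthesis_bounded m) hc.
  by rewrite -star_hip// -tail_adjoint// star_hip.
Qed.

Lemma tail_synthesis_basis m n : tail_synthesis m (hbasis n) = f (m + n)%N.
Proof. by rewrite /tail_synthesis pad_basis synthesis_basis. Qed.

(** The operator of the Riesz basis agrees with [tail_synthesis m] on the basis
    vectors, hence everywhere by continuity; its inverse is bounded. *)
Lemma riesz_tail_bounded_below m :
  let g := fun i => f (m + i)%N in
  modular_riesz_basis (hclosure (hspan g)) g -> tail_bounded_below m.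
Proof.
move=> g [cX _ [U [[bU [G [bG GU _]]] _ Ue]]].
have bU' : bounded_operator HA HA U.
  case: bU => XU DU aU CU; split=> //.
  by move=> x /XU; exact: csm_HA.
have bT := tail_synthesis_bounded m.
have TU c : HA c -> tail_synthesis m c = U c.
  move=> hc.
  have hs k : HA (\sum_(i < k) hact (c i) (f (m + i)%N)).
    by apply: HA_sum => i; apply: HAact; case: bf.
  apply: (hcvg_unique hs (bop_mem bT hc) (bop_mem bU' hc)).
    apply: hcvg_ext (bop_expand bT hc) => k.
    by apply: eq_bigr => i _; rewrite tail_synthesis_basis.
  apply: hcvg_ext (bop_expand bU' hc) => k.
  by apply: eq_bigr => i _; rewrite Ue.
have [C [_ HC]] := bop_bound bG.
exists C => c hc; rewrite TU// -{1}(GU c hc).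
exact: HC (bop_mem bU hc).
Qed.

(** The range of an operator bounded below is closed, so the closure of the span
    of the tail is exactly the range. *)
Lemma bounded_below_riesz_tail m : tail_bounded_below m ->
  let g := fun i => f (m + i)%N in
  modular_riesz_basis (hclosure (hspan g)) g.
Proof.
move=> [C HC] g.
have bT := tail_synthesis_bounded m.
have cX := range_closed cHA bT HC.
have hg n : HA (g n) by case: bf => + _; exact.
have gspan n : hspan g (g n).
  exists n.+1, (fun i => if i == n then cone else 0).
  rewrite big_ord_recr/= eqxx hact1 big1 ?add0r// => i _.
  by rewrite ltn_eqF// hact0l.
have XE : hclosure (hspan g) = [set tail_synthesis m c | c in HA].
  apply/seteqP; split=> [x [hx xg]|_ [c hc <-]].
    case: cX => _ _ _ _; apply; split=> // e /xg[_ [[k [c ->]] xe]].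
    exists (\sum_(i < k) hact (c i) (g i)); split=> //.
    exists (truncate k c); first exact (HA_truncate k c).
    rewrite (bop_truncate _ _ bT); apply: eq_bigr => i _.
    by rewrite tail_synthesis_basis.
  have hT := bop_mem bT hc; split=> // e e0.
  have /hcvgP/(_ _ e0)[N _ HN] := bop_expand bT hc.
  exists (\sum_(i < N) hact (c i) (g i)); split; first by exists N, c.
  rewrite hnorm_distC//; last by apply: HA_sum => i; exact: HAact.
  have -> : \sum_(i < N) hact (c i) (g i) =
      \sum_(i < N) hact (c i) (tail_synthesis m (hbasis i)).
    by apply: eq_bigr => i _; rewrite tail_synthesis_basis.
  exact: HN N (leqnn N).
have hgX n : hclosure (hspan g) (g n).
  split=> // e e0; exists (g n); split=> //.
  by rewrite subrr hnorm0.
have bTX : bounded_operator HA (hclosure (hspan g)) (tail_synthesis m).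
  rewrite XE; case: bT => _ TD Ta TC; split=> //.
  by move=> c hc; exists c.
split.
- by rewrite XE.
- by exists g.
- exists (tail_synthesis m); split.
  + apply: (hilbert_iso_of_below cHA _ bTX HC); first by rewrite XE.
    by rewrite XE => _ [c hc <-]; exists c.
  + exists (tail_analysis m); split.
      by move=> y [hy _]; exact: HA_tail_analysis.
    by move=> c y hc [hy _]; exact: tail_adjoint.
  + by move=> n; rewrite tail_synthesis_basis.
Qed.

(** With T the tail synthesis, H_A is the orthogonal sum of the range of T and
    of the kernel of T^*.  The preimage of the latter under F is a complement
    of the sequences vanishing before [m]. *)
Lemma bounded_below_fredholm m : tail_bounded_below m ->
  upper_semi_fredholm (synthesis f).
Proof.
move=> [C HC].
have bF := synthesis_bounded bf.
have bT := tail_synthesis_bounded m; have bW := tail_analysis_bounded m.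
have hT c : HA c -> HA (tail_synthesis m c) by move=> hc; exact (bop_mem bT hc).
have hW y : HA y -> HA (tail_analysis m y) by exact: HA_tail_analysis.
have hF c : HA c -> HA (synthesis f c) by exact: HA_synthesis.
have sS c : HA c -> HA (pad m c) by exact: HA_pad.
have gram c : HA c -> hip (tail_analysis m (tail_synthesis m c)) c =
    hip (tail_synthesis m c) (tail_synthesis m c).
  move=> hc; have hTc := hT _ hc; have hWT := hW _ hTc.
  by rewrite -star_hip// -tail_adjoint// star_hip.
(* T^* T is onto, so T^* y has the form T^* T z: then T z is the orthogonal
   projection of y to the range of T. *)
have solve y : HA y -> exists z, HA z /\
    tail_analysis m (tail_synthesis m z) = tail_analysis m y.
  move=> hy.
  have C0 : 0 < `|C| + 1 by have := normr_ge0 C; lra.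
  apply: (@positive_surjective _ _ HA _ (tail_synthesis m) (`|C| + 1)^-1 cHA
    (bounded_operator_comp bT bW)); [by rewrite invr_gt0| |exact: hW].
  move=> c hc; split; [exact: hT|exact: gram|].
  rewrite ler_pdivrMl//; apply: (le_trans (HC c hc)).
  by rewrite ler_wpM2r ?hnorm_ge0//; have := ler_norm C; lra.
have kerT z : HA z -> tail_analysis m (tail_synthesis m z) = 0 -> z = 0.
  move=> hz z0; have T0 : tail_synthesis m z = 0.
    by apply: hip0_eq0; [exact: hT|rewrite -gram// z0 hip0l].
  by apply: hnorm0_eq0 => //; rewrite (le_trans (HC z hz))// T0 hnorm0 mulr0.
pose M1 := [set pad m c | c in @HA R A].
pose M2 := [set tail_synthesis m c | c in @HA R A].
pose N2 := [set y | HA y /\ tail_analysis m y = 0].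
pose N1 := [set c | HA c /\ tail_analysis m (synthesis f c) = 0].
have cM1 : closed_submodule M1.
  apply: (@range_closed _ _ _ _ 1 cHA (pad_bounded m)) => c hc.
  by rewrite mul1r hnorm_pad.
have cM2 : closed_submodule M2 by exact: range_closed HC.
have cN2 : closed_submodule N2 by exact: kernel_closed.
have bWF := bounded_operator_comp bF bW.
have cN1 : closed_submodule N1 by exact: (kernel_closed bWF).
have M1N1 c : M1 c -> N1 c -> c = 0.
  move=> [d hd <-] [_ /(kerT d hd) ->].
  exact: bop0 cHA (pad_bounded m).
split=> //.
  by exists (analysis f); split; [exact: HA_analysis|exact: synthesis_adjoint].
exists M1, N1, M2, N2; split.
- split.
  + split=> //.
      apply/seteqP; split=> [c [Mc Nc]|_ ->]; first exact: M1N1.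
      by split; exact: csm0.
    apply/seteqP; split=> [_ [x Mx [y Ny <-]]|c hc].
      by apply: HAD; [exact (csm_HA cM1 Mx)|exact (csm_HA cN1 Ny)].
    have [z [hz Wz]] := solve _ (hF c hc).
    exists (pad m z); first by exists z.
    exists (c - pad m z); last by abelian.
    split; first exact (HAB hc (sS z hz)).
    have hsz := sS _ hz; have hFc := hF _ hc; have hFz := hF _ hsz.
    rewrite (bopB cHA bF hc hsz) (bopB cHA bW hFc hFz).
    by rewrite -/(tail_synthesis m z) Wz subrr.
  + split=> //.
      apply/seteqP; split=> [c [[d hd <-] [_ /(kerT d hd) ->]]|_ ->].
        exact: bop0 cHA bT.
      by split; exact: csm0.
    apply/seteqP; split=> [_ [x Mx [y Ny <-]]|y hy].
      by apply: HAD; [exact (csm_HA cM2 Mx)|exact (csm_HA cN2 Ny)].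
    have [z [hz Wz]] := solve _ hy; have hTz := hT _ hz.
    exists (tail_synthesis m z); first by exists z.
    exists (y - tail_synthesis m z); last by abelian.
    by split; [exact (HAB hy hTz)|rewrite (bopB cHA bW hy hTz) Wz subrr].
- split=> [_ [c hc <-]|c [hc Wc]]; first by exists c.
  by split=> //; exact: hF.
- apply: (@hilbert_iso_of_below _ _ M1 M2 _ C cM1 cM2).
  + case: bF => _ FD Fa [D HD]; split.
    * by move=> _ [c hc <-]; exists c.
    * by move=> x y Mx My; apply: FD; exact: csm_HA cM1 _ _.
    * by move=> a x Mx; apply: Fa; exact: csm_HA cM1 _ _.
    * by exists D => x Mx; apply: HD; exact: csm_HA cM1 _ _.
  + by move=> _ [c hc <-]; rewrite hnorm_pad//; exact: HC.
  + by move=> _ [c hc <-]; exists (pad m c); split=> //; exists c.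
- have /choice[z Hz] (i : 'I_m) : exists z, HA z /\
      tail_analysis m (tail_synthesis m z) =
      tail_analysis m (synthesis f (hbasis i)).
    by apply: solve; apply: hF; exact: HA_basis.
  have hz i : HA (z i) by case: (Hz i).
  (* The correction by z_i makes F (g_i) orthogonal to the range of T. *)
  pose g (i : 'I_m) := hbasis i - pad m (z i).
  have Ng i : N1 (g i).
    have hb := @HA_basis R A i; have hsz := sS _ (hz i).
    have hFb := hF _ hb; have hFz := hF _ hsz.
    split; first exact (HAB hb hsz).
    rewrite (bopB cHA bF hb hsz) (bopB cHA bW hFb hFz).
    case: (Hz i) => _; rewrite -/(tail_synthesis m (z i)) => ->.
    by rewrite subrr.
  exists m, g; apply/seteqP; split=> [c Nc|_ [c ->]]; last first.
    by apply: (csm_sum cN1) => i; exact (csm_act cN1 _ (Ng i)).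
  exists (fun i => c i); apply/eqP; rewrite -subr_eq0; apply/eqP.
  have Nd : N1 (\sum_(i < m) hact (c i) (g i)).
    by apply: (csm_sum cN1) => i; exact (csm_act cN1 _ (Ng i)).
  apply: M1N1; last exact (csmB cN1 Nc Nd).
  have -> : c - \sum_(i < m) hact (c i) (g i) = pad m (skip m c) +
      \sum_(i < m) hact (c i) (pad m (z i)).
    rewrite {1}(truncate_pad m c) /truncate.
    have -> : \sum_(i < m) hact (c i) (g i) =
      \sum_(i < m) hact (c i) (hbasis i) -
      \sum_(i < m) hact (c i) (pad m (z i)).
      by rewrite -sumrB; apply: eq_bigr => i _; rewrite hactBr.
    by abelian.
  have Mz i : M1 (pad m (z i)) by exists (z i).
  apply: (csmD cM1).
    by exists (skip m c) => //; apply: HA_skip; case: Nc.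
  by apply: (csm_sum cM1) => i; exact (csm_act cM1 _ (Mz i)).
Qed.

(** On a sequence h vanishing before a large m, the orthogonal projection to N1
    is small, because N1 is finitely generated.  What remains of h is
    orthogonal to N1, hence dominated by its component in M1, where F is
    bounded below. *)
Lemma fredholm_bounded_below : upper_semi_fredholm (synthesis f) ->
  exists2 m, (0 < m)%N & tail_bounded_below m.
Proof.
move=> [bF _ [M1 [N1 [M2 [N2 [[ds1 ds2] [FM FN] [_ [G [bG GF _]]] fgN1]]]]]].
have [cM1 cN1 MN1 sum1] := ds1; have [cM2 cN2 MN2 sum2] := ds2.
have [k [g N1E]] := fgN1.
have hN1 y : N1 y -> HA y by exact: csm_HA.
have hM1 y : M1 y -> HA y by exact: csm_HA.
have hM2 y : M2 y -> HA y by exact: csm_HA.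
have hN2 y : N2 y -> HA y by exact: csm_HA.
have M1N1 y : M1 y -> N1 y -> y = 0.
  by move=> My Ny; have : (M1 `&` N1) y by []; rewrite MN1.
have M2N2 y : M2 y -> N2 y -> y = 0.
  by move=> My Ny; have : (M2 `&` N2) y by []; rewrite MN2.
have hF c : HA c -> HA (synthesis f c) by move=> hc; exact (bop_mem bF hc).
pose g' (i : nat) : nat -> A := if insub i is Some j then g j else 0.
have g'E (i : 'I_k) : g' i = g i by rewrite /g' valK.
have Ng' i : N1 (g' i).
  rewrite /g'; case: insubP => [j _ _|_]; last exact: csm0.
  rewrite N1E; exists (fun l => if l == j then cone else 0).
  rewrite (bigD1 j)//= eqxx hact1 big1 ?addr0// => l /negbTE ->.
  by rewrite hact0l.
have hg' i : HA (g' i) by exact/hN1/Ng'.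
pose T c := \sum_(i < k) hact (c i) (g' i).
pose V y := fun i => hip y (g' i).
have NT c : N1 (T c) by apply: csm_sum => // i; exact: csm_act.
have hT c : HA (T c) by exact/hN1/NT.
have V0 y i : HA y -> (k <= i)%N -> V y i = 0.
  move=> hy ki; rewrite /V /g' insubF ?ltnNge ?ki//.
  by rewrite -star_hip ?hip0l ?star0//; exact: HA0.
have hV y : HA y -> HA (V y).
  by move=> hy; exact (HA_finite (fun i => V0 y i hy)).
have TV c y : HA c -> HA y -> hip (T c) y = hip c (V y).
  move=> hc hy; have hVy := hV _ hy.
  rewrite -[RHS]star_hip// (@hip_finite _ _ k (V y)); last first.
    exact (fun i => V0 y i hy).
  rewrite sip_star /T hip_suml//; last by move=> i; exact: HAact.
  rewrite /sip big_mkord; apply: eq_bigr => i _.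
  by rewrite hip_actl// /V star_hip.
have bT : bounded_operator HA HA T.
  split=> //.
  - move=> x y _ _; rewrite /T -big_split; apply: eq_bigr => i _ /=.
    by rewrite -hactDl.
  - move=> a x _; rewrite /T hact_sumr; apply: eq_bigr => i _.
    by rewrite hactA.
  - exists (\sum_(i < k) hnorm (g' i)) => c hc; rewrite /T mulr_suml.
    have : HA (T c) by [].
    rewrite /T; elim: (index_enum 'I_k) => [|i r IH].
      by rewrite !big_nil hnorm0.
    rewrite !big_cons => _.
    have hr : HA (\sum_(j <- r) hact (c j) (g' j)).
      by apply: HA_sum => j; exact: HAact.
    have hi : HA (hact (c i) (g' i)) by exact: HAact.
    apply: (le_trans (hnorm_add hi hr)); apply: lerD; last exact: IH.
    rewrite (le_trans (hnorm_act _ (hg' i)))// mulrC ler_wpM2l ?hnorm_ge0//.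
    exact: coord_le_hnorm.
have VT y c : HA y -> HA c -> hip (V y) c = hip y (T c).
  move=> hy hc; have hVy := hV _ hy.
  by rewrite -star_hip// -TV// star_hip.
have [CT [CT0 HCT]] := bop_bound bT.
have bV : bounded_operator HA HA V :=
  adjoint_bounded hV (fun c _ => hT c) VT HCT.
have [|C1 [C10 HC1]] := open_mapping cM1 cHA bT.
  move=> y hy; have : HA y by []; rewrite -{1}sum1 => -[m Mm [n Nn <-]].
  move: (Nn); rewrite N1E => -[c ->].
  exists m, (truncate k (fun i => if insub i is Some j then c j else 0)).
  split=> //; first exact (HA_truncate _ _).
  congr (_ + _); apply: eq_bigr => i _.
  by rewrite truncateE ltn_ord valK g'E.
(* The adjoint V of T is bounded below on N1: y = T c with |c| <= C1 |y|, so
   |y|^2 = |<c, V y>| <= C1 |y| |V y|. *)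
have NV y : N1 y -> hnorm y <= C1 * hnorm (V y).
  move=> Ny; have hy := hN1 _ Ny.
  have [m [c [Mm hc ymc _ cy]]] := HC1 y hy.
  have m0 : m = 0.
    apply: M1N1 => //; have -> : m = y - T c by rewrite ymc; abelian.
    exact: csmB.
  have yT : y = T c by rewrite ymc m0 add0r.
  have [y0|y0] := leP (hnorm y) 0.
    by rewrite (le_trans y0)// mulr_ge0 ?hnorm_ge0// ltW.
  rewrite -(ler_pM2r y0) -expr2 hnorm_sqr {1}yT TV//.
  apply: (le_trans (hip_cauchy_schwarz hc (hV _ hy))).
  by have := hnorm_ge0 (V y); nra.
have bS : bounded_operator N1 N1 (fun y => T (V y)).
  have [_ SD Sa [D HD]] := bounded_operator_comp bV bT.
  split=> //.
  - by move=> x y /hN1 hx /hN1 hy; exact: SD.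
  - by move=> a x /hN1 hx; exact: Sa.
  - by exists D => x /hN1 hx; exact: HD.
have SV y : HA y -> hip (T (V y)) y = hip (V y) (V y).
  by move=> hy; rewrite TV//; exact: hV.
have NS y : N1 y -> hnorm y <= C1 ^+ 2 * hnorm (T (V y)).
  move=> Ny; have hy := hN1 _ Ny.
  have [y0|y0] := leP (hnorm y) 0.
    by rewrite (le_trans y0)// mulr_ge0 ?hnorm_ge0// sqr_ge0.
  rewrite -(ler_pM2r y0) -expr2.
  have h1 : hnorm (V y) ^+ 2 <= hnorm (T (V y)) * hnorm y.
    by rewrite hnorm_sqr -SV//; exact: hip_cauchy_schwarz.
  apply: (@le_trans _ _ ((C1 * hnorm (V y)) ^+ 2)).
    rewrite ler_sqr ?nnegrE ?mulr_ge0 ?hnorm_ge0 ?(ltW C10)//.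
    exact: NV.
  by rewrite exprMn -[leRHS]mulrA ler_wpM2l// sqr_ge0.
(* The orthogonal projection of h to N1: T V is onto N1, and y solves
   T V y = T V h. *)
have proj h : HA h -> exists y, [/\ N1 y,
    hnorm y <= C1 ^+ 2 * (CT * hnorm (V h))
    & forall n, N1 n -> hip (h - y) n = 0].
  move=> hh; have hVh := hV _ hh.
  have [||y [Ny Sy]] :=
    @positive_surjective _ _ N1 _ V C1^-1 cN1 bS _ _ _ (NT (V h)).
  - by rewrite invr_gt0.
  - move=> y Ny; have hy := hN1 _ Ny; split; [exact: hV|exact: SV|].
    by rewrite ler_pdivrMl// NV.
  exists y; split=> //.
    rewrite (le_trans (NS y Ny))// Sy ler_wpM2l ?sqr_ge0//; exact: HCT.
  have hy := hN1 _ Ny; have hd := HAB hh hy; have hVy := hV _ hy.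
  have Vd : V (h - y) = 0.
    apply: hip0_eq0; first exact: hV.
    rewrite -SV// (bopB cHA bV)// (bopB cHA bT)// Sy subrr.
    exact: hip0l.
  move=> n Nn; have hn := hN1 _ Nn.
  have [m [c [Mm hc nmc _ _]]] := HC1 n hn.
  have m0 : m = 0.
    apply: M1N1 => //; have -> : m = n - T c by rewrite nmc; abelian.
    exact: csmB.
  have -> : n = T c by rewrite nmc m0 add0r.
  by rewrite -VT// Vd hip0l.
have bid : bounded_operator N2 HA id.
  by split=> //; exists 1 => x _; rewrite mul1r.
have [|C2 [C20 HC2]] := open_mapping cM2 cN2 bid.
  move=> y hy; have : HA y by [].
  by rewrite -{1}sum2 => -[m Mm [n Nn <-]]; exists m, n.
have split2 m n : M2 m -> N2 n -> hnorm m <= C2 * hnorm (m + n).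
  move=> Mm Nn.
  have [m' [n' [Mm' Nn' mn mC _]]] := HC2 _ (HAD (hM2 _ Mm) (hN2 _ Nn)).
  suff mm' : m = m' by rewrite {1}mm'.
  apply/eqP; rewrite -subr_eq0; apply/eqP/M2N2; first exact: csmB.
  have -> : m - m' = n' - n.
    have -> : m = (m' + n') - n by rewrite -mn; abelian.
    by abelian.
  exact: csmB.
have [C3 [C30 HC3]] := bop_bound bG.
have FM1 x : M1 x -> hnorm x <= C3 * hnorm (synthesis f x).
  by move=> Mx; rewrite -{1}(GF x Mx); apply/HC3/FM.
have [D [D0 HD]] := bop_bound bF.
pose K := C3 * C2; have K0 : 0 < K by rewrite mulr_gt0.
pose L := C1 ^+ 2 * CT; have L0 : 0 < L by rewrite mulr_gt0// exprn_gt0.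
have KD0 : 0 < K * D + 1 by rewrite addr_gt0// mulr_gt0.
(* With this eta, (K D + 1) |y| is at most |c| / 2 in the final estimate. *)
pose eta := (2 * (K * D + 1) * L)^-1.
have eta0 : 0 < eta by rewrite invr_gt0 !mulr_gt0.
have sum_small j e : 0 < e -> exists N, forall m, (N <= m)%N ->
    \sum_(i < j) hnorm (skip m (g' i)) <= e.
  elim: j e => [|j IH] e e0; first by exists 0%N => m _; rewrite big_ord0 ltW.
  have e20 : 0 < e / 2 by lra.
  have [N HN] := IH _ e20; have [N' HN'] := skip_small (hg' j) e20.
  exists (maxn N N') => m; rewrite geq_max => /andP[Nm N'm].
  rewrite big_ord_recr/=; have := HN m Nm; have := HN' m N'm; lra.
have [N HN] := sum_small k eta eta0.
exists (maxn N 1); first by rewrite leq_max orbT.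
set m := maxn N 1; have Nm : (N <= m)%N by rewrite leq_maxl.
exists (2 * K) => c hc; set h := pad m c; have hh : HA h by exact: HA_pad.
have hch : hnorm h = hnorm c by exact: hnorm_pad.
have Vh : hnorm (V h) <= eta * hnorm c.
  rewrite -(@truncate_finite _ _ k (V h)); last exact (fun i => V0 h i hh).
  apply: (le_trans (hnorm_truncate _ _)).
  apply: (@le_trans _ _ (\sum_(i < k) hnorm (skip m (g' i)) * hnorm c)).
    apply: ler_sum => i _; rewrite /V hip_pad// mulrC.
    by apply: hip_cauchy_schwarz => //; exact: HA_skip.
  by rewrite -mulr_suml ler_wpM2r ?hnorm_ge0// HN.
have [y [Ny yh yorth]] := proj h hh; have hy := hN1 _ Ny.
have yc : (K * D + 1) * hnorm y <= hnorm c / 2.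
  have h1 : hnorm y <= L * (eta * hnorm c).
    rewrite (le_trans yh)// mulrA ler_wpM2l// ltW//.
  apply: (le_trans (ler_wpM2l (ltW KD0) h1)).
  have -> : (K * D + 1) * (L * (eta * hnorm c)) = hnorm c / 2; last by [].
  by rewrite /eta; field; rewrite !gt_eqF.
have hd := HAB hh hy.
have : HA (h - y) by []; rewrite -{1}sum1 => -[c1 Mc1 [n Nn c1n]].
have hc1 := hM1 _ Mc1; have hn := hN1 _ Nn.
(* Since h - y = c1 + n is orthogonal to n, <h - y, h - y> = <h - y, c1>. *)
have d_le_c1 : hnorm (h - y) <= hnorm c1.
  have [d0|d0] := leP (hnorm (h - y)) 0.
    by rewrite (le_trans d0)// hnorm_ge0.
  rewrite -(ler_pM2l d0) -expr2 hnorm_sqr.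
  have -> : hip (h - y) (h - y) = hip (h - y) c1.
    by rewrite -{2}c1n hipDr// (yorth n Nn) addr0.
  exact: hip_cauchy_schwarz.
have c1_le : hnorm c1 <= K * hnorm (synthesis f (h - y)).
  apply: (le_trans (FM1 _ Mc1)); rewrite /K -mulrA.
  apply: ler_wpM2l; first exact: ltW.
  rewrite -c1n (bopD bF hc1 hn).
  exact (split2 _ _ (FM _ Mc1) (FN _ Nn)).
have Fd : hnorm (synthesis f (h - y)) <= hnorm (synthesis f h) + D * hnorm y.
  rewrite (bopB cHA bF hh hy).
  apply: (le_trans (hnorm_sub (hF _ hh) (hF _ hy))).
  by rewrite lerD2l; exact: HD.
have h_le : hnorm h <= hnorm (h - y) + hnorm y.
  have {1}-> : h = (h - y) + y by abelian.
  exact: hnorm_add.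
rewrite /tail_synthesis -/h; set Fh := hnorm (synthesis f h) in Fd *.
have := ler_wpM2l (ltW K0) Fd; rewrite hch in h_le.
by move: yc; lra.
Qed.

End TailSynthesis.

Theorem proposition2p4 (R : realType) (A : cstarAlgType R)
    (x : nat -> nat -> A) (hx : bessel x) :
  pseudo_riesz x <-> upper_semi_fredholm (synthesis x).
Proof.
split=> [[_ [m [_ rm]]]|Fx].
  exact: bounded_below_fredholm (riesz_tail_bounded_below hx rm).
split=> //; have [m m0 Tm] := fredholm_bounded_below Fx.
by exists m; split=> //; exact: bounded_below_riesz_tail.
Qed.
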